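(* Let $d\ge 2$, $\Omega=\{0,1\}^{\mathbb{Z}^d}$. Let $\mathbb{P}$ be a nonuniformly exponentially $\varphi$-mixing Gibbs measure on $\Omega$ and let $\mathbb{Q}$ be a stationary and ergodic Gibbs measure on $\Omega$. Assume that the rate distortion function $\mathcal{R}(\varepsilon)=\mathcal{R}(\mathbb{Q},\mathbb{P},\varepsilon)$ is strictly positive on $[0,\varepsilon_0)$. Then for all $\alpha\in(0,1)$ and $\varepsilon>0$ small enough, namely with $\varepsilon/\alpha<\varepsilon_0$, there exist constants $\Lambda_1,\Lambda_2,C,c,K\in(0,\infty)$ and, for each $n$-pattern $A_n$, a number $\Lambda_n=\Lambda(A_n)$ with $\Lambda_1\le \Lambda_n\le\Lambda_2$, such that for every $t>0$, every $n\ge 1$, and $\mathbb{Q}$-almost every $\omega$ with $\omega_{C_n}\in\mathcal{G}_n(\varepsilon,\alpha)$, $$\left|\mathbb{P}\left(\mathbf{T}_{[\omega_{C_n}]^\varepsilon}>\frac{t}{\Lambda_n\,\mathbb{P}([\omega_{C_n}]^\varepsilon)}\right)-e^{-t}\right|\le C e^{-ct}e^{-Kn^d},$$ where $\Lambda_n=\Lambda(\omega_{C_n})$.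
   Context: Configurations $\sigma,\eta,\omega\in\Omega=\{0,1\}^{\mathbb{Z}^d}$; for $V\subseteq\mathbb{Z}^d$, $\mathcal{F}_V$ is the $\sigma$-algebra generated by $\{\sigma_x:x\in V\}$. For finite $V$, $\Delta(V,\eta,\sigma)=\sum_{x\in V}|\eta_x-\sigma_x|$ (Hamming distance on $V$). $C_n=[0,n]^d\cap\mathbb{Z}^d$. An $n$-pattern is a map $A_n:C_n\to\{0,1\}$; $[A_n]=\{\sigma:\sigma_{C_n}=A_n\}$ and $[A_n]^\varepsilon=\{\omega\in\Omega:\Delta(C_n,\omega,A_n)\le\varepsilon|C_n|\}$. For $x\in\mathbb{Z}^d$, $\theta_x[A_n]^\varepsilon$ denotes the translate of this event by $x$, i.e. the set of $\omega$ whose restriction to $C_n+x$, translated back to $C_n$, lies within Hamming distance $\varepsilon|C_n|$ of $A_n$. Approximate hitting time: $\mathbf{T}_{[A_n]^\varepsilon}(\sigma)=\min\{|C_k|:k>0,\ \exists x\in\mathbb{Z}^d \text{ with } C_n+x\subseteq C_k \text{ such that the restriction of }\sigma\text{ to }C_n+x,\text{ translated to }C_n,\text{ lies in }[A_n]^\varepsilon\}$. Good patterns: for $0<\alpha<1$, $0\le\varepsilon<1$, an $n$-pattern $A_n$ is $(\varepsilon,\alpha)$-good if $[A_n]^\varepsilon\cap\theta_x[A_n]^\varepsilon=\emptyset$ for all $x\in\mathbb{Z}^d$ with $0<|x|\le\alpha n$ ($|\cdot|$ the sup-norm); $\mathcal{G}_n(\varepsilon,\alpha)$ is the set of such patterns.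 Mixing: for $m>0$, $\varphi(m)=\sup\frac{1}{|A_1|}|\mathbb{P}(E_{A_1}\mid E_{A_2})-\mathbb{P}(E_{A_1})|$, the supremum over finite $A_1,A_2\subset\mathbb{Z}^d$ with $d(A_1,A_2)\ge m$ (sup-norm distance) and $E_{A_i}\in\mathcal{F}_{A_i}$ with $\mathbb{P}(E_{A_2})>0$; $\mathbb{P}$ is nonuniformly exponentially $\varphi$-mixing if $\varphi(m)\le C_1e^{-C_2m}$ for all $m>0$, some $C_1,C_2>0$. Rate distortion function: $\mathcal{R}(\mathbb{Q},\mathbb{P},\varepsilon)=\lim_n \mathcal{R}_n$, where $\mathcal{R}_n=\inf_{\mathbb{J}_n}\frac{1}{|C_n|}H(\mathbb{J}_n\|\mathbb{Q}_n\times\mathbb{P}_n)$, the infimum over joint distributions $\mathbb{J}_n$ on $\{0,1\}^{C_n}\times\{0,1\}^{C_n}$ whose first marginal is $\mathbb{Q}_n$ (the $C_n$-marginal of $\mathbb{Q}$) and with $\int\frac{\Delta(C_n,\omega,\sigma)}{|C_n|}d\mathbb{J}_n(\omega,\sigma)\le\varepsilon$; $H$ is relative entropy and $\mathbb{P}_n$ the $C_n$-marginal of $\mathbb{P}$. *)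

(* Defs.v *)
From HB Require Import structures.
From mathcomp Require Import all_boot all_order all_algebra finmap.
From mathcomp Require Import all_classical all_reals all_analysis.

Set Implicit Arguments.
Unset Strict Implicit.
Unset Printing Implicit Defensive.

Import Order.TTheory GRing.Theory Num.Theory.
Local Open Scope classical_set_scope.
Local Open Scope ring_scope.

Definition site (d : nat) := {ffun 'I_d -> int}.

Definition sadd d (x y : site d) : site d := [ffun i => x i + y i].
Definition sorigin d : site d := [ffun _ => 0].

Definition sdist d (x y : site d) : nat := \max_(i < d) `|x i - y i|%N.

Definition cylinders (d : nat) : set (set (site d -> bool)) :=
  [set E | exists (x : site d) (b : bool), E = [set s | s x = b]].

Definition Omega (d : nat) := g_sigma_algebraType (@cylinders d).

Definition tshift d (x : site d) (s : Omega d) : Omega d := fun y => s (sadd y x).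

(* E is F_A-measurable, A finite: membership in E only depends on sigma_A
   (for a finite A this is exactly the sigma-algebra generated by
   {sigma_x : x in A}) *)
Definition depends_on d (A : {fset site d}) (E : set (Omega d)) :=
  forall s s' : Omega d, (forall x, x \in A -> s x = s' x) -> (E s <-> E s').

Definition box (d n : nat) := {ffun 'I_d -> 'I_n.+1}.
Definition emb d n (y : box d n) : site d := [ffun i => ((y i : nat)%:Z)].

Definition inC d (k : nat) (z : site d) := forall i, 0 <= z i <= k%:Z.

Definition patt (d n : nat) := {ffun box d n -> bool}.

Definition restr d n (s : Omega d) : patt d n := [ffun y => s (emb y)].

Definition cyl d n (A : patt d n) : set (Omega d) := [set s | restr n s = A].

Definition hamming d n (w : Omega d) (A : patt d n) : nat :=
  \sum_(y : box d n) (w (emb y) != A y).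

Definition approx_ball (R : realType) d n (A : patt d n) (eps : R) : set (Omega d) :=
  [set w | (hamming w A)%:R <= eps * (#|{: box d n}|)%:R].

Definition good (R : realType) d n (eps alpha : R) (A : patt d n) :=
  forall x : site d, (0 < sdist x (sorigin d))%N ->
    (sdist x (sorigin d))%:R <= alpha * n%:R ->
    approx_ball A eps `&` (tshift x @^-1` approx_ball A eps) = set0.

(* approximate hitting time T_{[A_n]^eps} (value +oo if never hit) *)
Definition hitting_time (R : realType) d n (A : patt d n) (eps : R)
  (s : Omega d) : \bar R :=
  ereal_inf [set ((#|{: box d k}|)%:R)%:E | k in
     [set k : nat | (0 < k)%N /\
        exists x : site d, (forall y : box d n, inC k (sadd (emb y) x)) /\
                           approx_ball A eps (tshift x s)]].

Definition stationary (R : realType) d (P : probability (Omega d) R) :=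
  forall (x : site d) (E : set (Omega d)), measurable E ->
    P (tshift x @^-1` E) = P E.

Definition ergodic (R : realType) d (P : probability (Omega d) R) :=
  forall E : set (Omega d), measurable E ->
    (forall x : site d, tshift x @^-1` E = E) -> P E = 0%E \/ P E = 1%E.

(* nonuniformly exponentially phi-mixing: phi(m) <= C1 exp(-C2 m), i.e.
   for all admissible A1, A2, E1, E2 the quantity inside the sup is bounded *)
Definition nonunif_exp_phi_mixing (R : realType) d (P : probability (Omega d) R) :=
  exists C1 C2 : R, 0 < C1 /\ 0 < C2 /\
  forall m : R, 0 < m ->
  forall (A1 A2 : {fset site d}),
    (forall x y, x \in A1 -> y \in A2 -> m <= (sdist x y)%:R) ->
  forall E1 E2 : set (Omega d), depends_on A1 E1 -> depends_on A2 E2 ->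
    (0 < P E2)%E ->
    `| fine (P (E1 `&` E2)) / fine (P E2) - fine (P E1) | / (#|` A1|)%:R
      <= C1 * expR (- C2 * m).

Definition interaction (R : realType) d := {fset site d} -> Omega d -> R.

Definition local_interaction (R : realType) d (Phi : interaction R d) :=
  forall (A : {fset site d}) (s s' : Omega d),
    (forall x, x \in A -> s x = s' x) -> Phi A s = Phi A s'.

Definition transl_invariant (R : realType) d (Phi : interaction R d) :=
  forall (A : {fset site d}) (x : site d) (s : Omega d),
    Phi [fset sadd a x | a in A]%fset s = Phi A (tshift x s).

Definition abs_summable (R : realType) d (Phi : interaction R d) :=
  (\esum_(A in [set A : {fset site d} | sorigin d \in A])
      ereal_sup [set (`|Phi A s|)%:E | s in [set: Omega d]] < +oo)%E.

Definition meets_fs d (L : {fset site d}) : set {fset site d} :=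
  [set A | (A `&` L != fset0)%fset].

(* Hamiltonian H_Lambda(sigma) = sum_{A : A cap Lambda <> 0} Phi_A(sigma)
   (absolutely convergent sum: positive part minus negative part) *)
Definition hamiltonian (R : realType) d (Phi : interaction R d)
  (L : {fset site d}) (s : Omega d) : R :=
  fine (\esum_(A in meets_fs L) (Num.max (Phi A s) 0)%:E) -
  fine (\esum_(A in meets_fs L) (Num.max (- Phi A s) 0)%:E).

Definition glue_cfg d (L : {fset site d}) (xi : {ffun L -> bool}) (eta : Omega d)
  : Omega d :=
  fun y => if (insub y : option L) is Some z then xi z else eta y.

Definition gibbs_spec (R : realType) d (Phi : interaction R d)
  (L : {fset site d}) (B : set (Omega d)) (eta : Omega d) : R :=
  (\sum_(xi : {ffun L -> bool})
      \1_B (glue_cfg xi eta) * expR (- hamiltonian Phi L (glue_cfg xi eta))) /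
  (\sum_(xi : {ffun L -> bool}) expR (- hamiltonian Phi L (glue_cfg xi eta))).

Definition is_gibbs (R : realType) d (P : probability (Omega d) R) :=
  exists Phi : interaction R d,
    [/\ local_interaction Phi, transl_invariant Phi, abs_summable Phi &
      forall (L : {fset site d}) (B : set (Omega d)), measurable B ->
        P B = (\int[P]_eta (gibbs_spec Phi L B eta)%:E)%E].

Definition marg (R : realType) d (P : probability (Omega d) R) n
  (a : patt d n) : R := fine (P (cyl a)).

Definition hamming_pat d n (a b : patt d n) : nat :=
  \sum_(y : box d n) (a y != b y).

Definition admissible (R : realType) d (Q : probability (Omega d) R) n (eps : R)
  (J : patt d n -> patt d n -> R) :=
  [/\ forall a b, 0 <= J a b,
      \sum_a \sum_b J a b = 1,
      forall a, \sum_b J a b = @marg R d Q n a &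
      \sum_a \sum_b J a b * ((hamming_pat a b)%:R / (#|{: box d n}|)%:R) <= eps].

(* relative entropy H(J || Q_n x P_n), with 0 ln 0 = 0 and value +oo when
   J is not absolutely continuous w.r.t. Q_n x P_n *)
Definition rel_entropy (R : realType) d n (J : patt d n -> patt d n -> R)
  (Qn Pn : patt d n -> R) : \bar R :=
  (\sum_a \sum_b
     (if J a b == 0%R then 0%E
      else if (Qn a * Pn b == 0)%R then +oo%E
      else (J a b * ln (J a b / (Qn a * Pn b)))%:E))%E.

Definition rate_distortion_n (R : realType) d (Q P : probability (Omega d) R)
  (eps : R) (n : nat) : \bar R :=
  ereal_inf [set (rel_entropy J (@marg R d Q n) (@marg R d P n) * ((#|{: box d n}|)%:R^-1)%:E)%E
            | J in [set J | @admissible R d Q n eps J]].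

Definition rate_distortion (R : realType) d (Q P : probability (Omega d) R)
  (eps : R) : \bar R := limn (rate_distortion_n Q P eps).

(* Main.v *)
(* A mixing Gibbs measure [P] is the only Gibbs measure for its interaction, hence
   stationary, and finite energy gives [p := P([A]^eps) >= exp(- C n^d)]. Goodness says
   that the translates of [A] are a code of minimal distance about [2 eps n^d], so a
   Plotkin counting argument forces the mean Hamming distance to [A] above
   [(eps + del) n^d]; concentration under mixing then gives [p <= exp(- kap n^d)], also
   conditionally on events far from [C_n].
   Occurrences of [[A]^eps] at distance at most [alpha n] exclude each other and distant
   ones are nearly uncorrelated, so the probability [q] of an occurrence in a cube of side
   [f] (exponentially large in [n^d], but with [f^d p] small) is comparable to [f^d p]. Cutting a large
   cube into such blocks separated by corridors of width of order [n^d], the non-occurrence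
   probability is close to a power of [1 - q]; hence [Lam := - ln (1 - q) / (f^d p)]. The
   factor [exp(- c t)] comes from interpolating between this bound, linear in [t], and
   an exponential tail bound. *)

Require Import Defs.
From HB Require Import structures.
From mathcomp Require Import all_boot all_order all_algebra finmap.
From mathcomp Require Import all_classical all_reals all_analysis.
From mathcomp Require Import measurable_realfun ring lra zify.
Set Implicit Arguments.
Unset Strict Implicit.
Unset Printing Implicit Defensive.
Import Order.TTheory GRing.Theory Num.Theory.
Local Open Scope classical_set_scope.
Local Open Scope ring_scope.

(** * Events determined by finitely many sites *)

(** The ball probability p is only known to exceed exp(- C0 N), with N = (n+1)^d, while mixing
    across a gap of order n leaves an error of order exp(- C2 n). For d >= 2, mixing alone therefore
    cannot decorrelate two occurrences at such a distance. Its substitute is a concentration bound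
    carrying [pr P E] as a factor: after any event at a suitable constant distance the ball still
    costs exp(- kap N), so two occurrences that do not exclude each other have joint probability at
    most p exp(- kap N). Mixing is used in additive form only between large cubes, where its factor
    |A1| is of order f^d. A corridor of width m of order N makes exp(- C2 m) at most p exp(- kap N),
    yet stays negligible beside f, which is exponential in N. The growth of f^d is held to exp(kap N
    / 4), so that even p f^(2d), the cost of a boundary layer, is exponentially small. Reading [Lam]
    off from q makes the power of 1 - q an exact exponential of the volume covered by the blocks;
    the rest of the error is a comparison of volumes. *)

Lemma measurable_coord d (x : site d) (b : bool) :
  measurable ([set s | s x = b] : set (Omega d)).
Proof. by apply: sub_sigma_algebra; exists x, b. Qed.

(** Membership is decided by one of finitely many configurations on [A], so [E] is a finite union of
    cylinders; the value [false] outside [A] is an arbitrary filler. *)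
Lemma measurable_depends_on d (A : {fset site d}) (E : set (Omega d)) :
  depends_on A E -> measurable E.
Proof.
move=> AE.
have -> : E = \bigcup_(xi in [set xi : {ffun A -> bool} |
      E (glue_cfg xi (fun=> false))])
    \big[setI/setT]_(x <- enum_fset A)
      [set s : Omega d | s x = glue_cfg xi (fun=> false) x].
  apply/seteqP; split=> s.
    move=> Es; exists [ffun z : A => s (val z)] => /=.
      apply/(AE s) => // x xA.
      by rewrite /glue_cfg insubT /= ffunE.
    rewrite -bigcap_seq => x /= xA.
    by rewrite /glue_cfg insubT /= ffunE.
  move=> [xi /= Exi]; rewrite -bigcap_seq => sxi.
  by apply/(AE _ _ _).2/Exi => x xA; apply: sxi.
apply: fin_bigcup_measurable; first exact: finite_finset.
move=> xi _; elim/big_ind : _ => //; first by move=> *; exact: measurableI.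
by move=> x _; exact: measurable_coord.
Qed.

Section depends.
Context (d : nat).
Implicit Types (A B : {fset site d}) (E F : set (Omega d)).

Lemma depends_onS A B E : {subset A <= B} -> depends_on A E -> depends_on B E.
Proof. by move=> AB AE s s' ss'; apply: AE => x /AB; exact: ss'. Qed.

Lemma depends_onC A E : depends_on A E -> depends_on A (~` E).
Proof. by move=> AE s s' /AE ss' /=; split=> + /ss'. Qed.

Lemma depends_onI A E F : depends_on A E -> depends_on A F ->
  depends_on A (E `&` F).
Proof.
by move=> AE AF s s' ss'; split=> -[/(AE _ _ ss') ? /(AF _ _ ss') ?]; split.
Qed.

Lemma depends_onT A : depends_on A setT.
Proof. by []. Qed.

End depends.

Section pr.
Context (R : realType) (d : nat) (P : probability (Omega d) R).
Implicit Types (E F : set (Omega d)).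

Definition pr E : R := fine (P E).

Lemma prE E : measurable E -> P E = (pr E)%:E.
Proof. by move=> mE; rewrite /pr fineK ?fin_num_measure//. Qed.

Lemma pr_ge0 E : 0 <= pr E.
Proof. exact/fine_ge0/measure_ge0. Qed.

Lemma pr_le E F : measurable E -> measurable F -> E `<=` F -> pr E <= pr F.
Proof.
by move=> mE mF EF; rewrite -lee_fin -!prE//; apply: le_measure => //; rewrite inE.
Qed.

Lemma prT : pr setT = 1.
Proof. by rewrite /pr probability_setT. Qed.

Lemma pr0 : pr set0 = 0.
Proof. by rewrite /pr measure0. Qed.

Lemma pr_le1 E : measurable E -> pr E <= 1.
Proof. by move=> mE; rewrite -prT pr_le. Qed.

Lemma prID E F : measurable E -> measurable F ->
  pr E = pr (E `&` F) + pr (E `&` ~` F).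
Proof.
move=> mE mF; have mEF := measurableI _ _ mE mF.
have mEF' := measurableI _ _ mE (measurableC mF).
apply: EFin_inj; rewrite EFinD -!prE// -measureU//.
  by rewrite -setIUr setUv setIT.
by rewrite setIACA setICr setI0.
Qed.

Lemma prC E : measurable E -> pr (~` E) = 1 - pr E.
Proof.
move=> mE; have := prID (@measurableT _ (Omega d)) mE.
by rewrite !setTI prT => ->; rewrite addrC addKr.
Qed.

Lemma prU_le E F : measurable E -> measurable F -> pr (E `|` F) <= pr E + pr F.
Proof.
move=> mE mF; have mEF := measurableU _ _ mE mF.
have mFE := measurableI _ _ mEF (measurableC mE).
rewrite (prID mEF mE) lerD//; last by apply: pr_le => // x [[]].
by apply: pr_le => //; exact: measurableI.
Qed.

End pr.

Lemma pr_leIl (R : realType) d (P : probability (Omega d) R) E F :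
  measurable E -> measurable F -> pr P (E `&` F) <= pr P E.
Proof. by move=> mE mF; rewrite (prID P mE mF) lerDl pr_ge0. Qed.

(** * The Hamiltonian *)

Definition sopp d (x : site d) : site d := [ffun i => - x i].

Lemma saddK d (x : site d) : cancel (fun y => sadd y x) (fun y => sadd y (sopp x)).
Proof. by move=> y; apply/ffunP => i; rewrite !ffunE addrK. Qed.

Lemma saddNK d (x : site d) : cancel (fun y => sadd y (sopp x)) (fun y => sadd y x).
Proof. by move=> y; apply/ffunP => i; rewrite !ffunE subrK. Qed.

Lemma saddA d (x y z : site d) : sadd x (sadd y z) = sadd (sadd x y) z.
Proof. by apply/ffunP => i; rewrite !ffunE addrA. Qed.

Lemma saddC d (x y : site d) : sadd x y = sadd y x.
Proof. by apply/ffunP => i; rewrite !ffunE addrC. Qed.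

Lemma sadd0 d (x : site d) : sadd x (sorigin d) = x.
Proof. by apply/ffunP => i; rewrite !ffunE addr0. Qed.

Lemma saddI d (x : site d) : injective (fun y => sadd y x).
Proof. exact: can_inj (saddK x). Qed.

Lemma tshiftD d (x y : site d) (s : Omega d) :
  tshift x (tshift y s) = tshift (sadd x y) s.
Proof. by apply/funext => z; rewrite /tshift saddA. Qed.

Lemma tshift0 d (s : Omega d) : tshift (sorigin d) s = s.
Proof. by apply/funext => z; rewrite /tshift sadd0. Qed.

Lemma saddN d (x : site d) : sadd x (sopp x) = sorigin d.
Proof. by apply/ffunP => i; rewrite !ffunE subrr. Qed.

Definition ftranslate d (x : site d) (A : {fset site d}) : {fset site d} :=
  [fset sadd a x | a in A]%fset.

Lemma mem_ftranslate d (x : site d) A y : (y \in ftranslate x A) = (sadd y (sopp x) \in A).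
Proof.
apply/imfsetP/idP => [[a aA ->]|yA]; first by rewrite saddK.
by exists (sadd y (sopp x)) => //; rewrite saddNK.
Qed.

Lemma ftranslateK d (x : site d) : cancel (ftranslate x) (ftranslate (sopp x)).
Proof.
move=> A; apply/fsetP => y; rewrite !mem_ftranslate.
suff -> : sadd (sadd y (sopp (sopp x))) (sopp x) = y by [].
by apply/ffunP => i; rewrite !ffunE opprK addrK.
Qed.

Lemma ftranslateNK d (x : site d) : cancel (ftranslate (sopp x)) (ftranslate x).
Proof.
move=> A; apply/fsetP => y; rewrite !mem_ftranslate.
suff -> : sadd (sadd y (sopp x)) (sopp (sopp x)) = y by [].
by apply/ffunP => i; rewrite !ffunE opprK subrK.
Qed.

Lemma card_ftranslate d (x : site d) A : #|` ftranslate x A| = #|` A|.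
Proof. by rewrite /ftranslate card_imfset//; exact: saddI. Qed.

Section integral_lower_bound.
Import HBNNSimple.

(** The integral of a nonnegative function is a supremum over simple functions below it, and [c]
    times the indicator of [F] is one. This applies to [gibbs_spec] directly, without first studying
    its measurability in the boundary condition. *)
Lemma integral_ge_indic d (T : measurableType d) (R : realType)
    (mu : probability T R) (F : set T) (f : T -> R) (c : R) :
  measurable F -> 0 <= c -> (forall x, 0 <= f x) -> (forall x, F x -> c <= f x) ->
  (c%:E * mu F <= \int[mu]_x (f x)%:E)%E.
Proof.
move=> mF c0 f0 cf.
rewrite ge0_integralE//; last by move=> x _; rewrite lee_fin.
have -> : (c%:E * mu F = \int[mu]_x (scale_nnsfun (indic_nnsfun R mF) c0 x)%:E)%E.
  under eq_integral do rewrite /= EFinM.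
  rewrite ge0_integralZl//=.
  - by rewrite integral_indic// setIT.
  - by apply/measurable_EFinP; exact: measurable_indic.
  - by move=> x _; rewrite lee_fin /mindic indicE.
rewrite integral_nnsfun// patch_setT.
apply: ereal_sup_ubound; exists (scale_nnsfun (indic_nnsfun R mF) c0) => //= x.
rewrite patch_setT/= lee_fin /mindic indicE.
by have [/set_mem/cf|] := boolP (x \in F); rewrite ?mulr1 ?mulr0.
Qed.

End integral_lower_bound.

Section hamiltonian_bounds.
Context (R : realType) (d : nat) (Phi : interaction R d).
Hypotheses (HL : local_interaction Phi) (HT : transl_invariant Phi)
  (HS : abs_summable Phi).
Local Open Scope ereal_scope.

Definition int_norm (A : {fset site d}) : \bar R :=
  ereal_sup [set (`|Phi A s|%R)%:E | s in [set: Omega d]].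

Lemma int_norm_ge A s : (`|Phi A s|%R)%:E <= int_norm A.
Proof. by apply: ereal_sup_ubound; exists s. Qed.

Lemma int_norm_ge0 A : 0 <= int_norm A.
Proof. by apply: le_trans (int_norm_ge A (fun=> false)); rewrite lee_fin. Qed.

Definition norm_at (x : site d) : \bar R :=
  \esum_(A in [set A : {fset site d} | x \in A]) int_norm A.

Definition inorm : R := fine (norm_at (sorigin d)).

Lemma int_norm_ftranslate x A : int_norm (ftranslate x A) = int_norm A.
Proof.
rewrite /int_norm; congr ereal_sup; apply/seteqP; split=> _ [s _ <-].
  by exists (tshift x s) => //; rewrite -HT.
exists (tshift (sopp x) s) => //.
by rewrite (HT A x) tshiftD saddN tshift0.
Qed.

Lemma norm_atE x : norm_at x = inorm%:E.
Proof.
rewrite /inorm fineK; last first.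
  by rewrite ge0_fin_numE ?esum_ge0// => A _; exact: int_norm_ge0.
rewrite /norm_at (@reindex_esum _ _ _ [set A : {fset site d} | sorigin d \in A] _ (ftranslate x)).
  by apply: eq_esum => A _; exact: int_norm_ftranslate.
split=> [A /= A0|A B _ _ |A /= xA].
- by rewrite mem_ftranslate saddN.
- exact/can_inj/ftranslateK.
- exists (ftranslate (sopp x) A) => /=.
    rewrite mem_ftranslate (_ : sadd _ _ = x)//.
    by apply/ffunP => i; rewrite !ffunE opprK add0r.
  exact: ftranslateNK.
Qed.

Lemma inorm_ge0 : (0 <= inorm)%R.
Proof. by apply: fine_ge0; apply: esum_ge0 => A _; exact: int_norm_ge0. Qed.

(** A set meeting [L] contains at least one site of [L], so it is counted at least once when the
    norms at the sites of [L] are added. *)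
Lemma esum_meets_le (L : {fset site d}) :
  \esum_(A in meets_fs L) int_norm A <= (#|` L|%:R * inorm)%:E.
Proof.
have -> : (#|` L|%:R * inorm)%:E = \sum_(x <- enum_fset L) norm_at x.
  under eq_bigr do rewrite norm_atE.
  by rewrite sumEFin big_const_seq count_predT iter_addr_0 mulr_natl.
rewrite /norm_at.
under [leRHS]eq_bigr => x _ do
  rewrite -[X in esum X _]setIT esum_mkcondl.
rewrite -esum_sum; last by move=> A x _ _; case: ifP => // _; exact: int_norm_ge0.
rewrite esum_mkcond; apply: le_esum => A _.
case: ifPn => [/set_mem/fset0Pn[x]|_]; last first.
  by apply: sume_ge0 => x _; case: ifP => // _; exact: int_norm_ge0.
rewrite inE => /andP[xA xL].
rewrite (big_rem x)//= ifT; last by rewrite inE.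
apply: leeDl; apply: sume_ge0 => y _; case: ifP => // _; exact: int_norm_ge0.
Qed.

Lemma esum_part_le (D : set {fset site d}) (f : {fset site d} -> R) :
  (forall A, ((f A)%:E <= int_norm A)) ->
  \esum_(A in D) (f A)%:E <= \esum_(A in D) int_norm A.
Proof. by move=> fle; apply: le_esum. Qed.

Let posp s A : R := (Num.max (Phi A s) 0)%R.
Let negp s A : R := (Num.max (- Phi A s) 0)%R.

Let posp_le s A : (posp s A)%:E <= int_norm A.
Proof.
apply: le_trans (int_norm_ge A s); rewrite lee_fin /posp ge_max ler_norm /=.
by rewrite normr_ge0.
Qed.

Let negp_le s A : (negp s A)%:E <= int_norm A.
Proof.
apply: le_trans (int_norm_ge A s).
by rewrite lee_fin /negp ge_max -normrN ler_norm normr_ge0.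
Qed.

Let posp_ge0 s A : 0 <= (posp s A)%:E.
Proof. by rewrite lee_fin /posp le_max lexx orbT. Qed.
Let negp_ge0 s A : 0 <= (negp s A)%:E.
Proof. by rewrite lee_fin /negp le_max lexx orbT. Qed.

Let part_fin (f : {fset site d} -> R) L : (forall A, 0 <= (f A)%:E) ->
  (forall A, ((f A)%:E <= int_norm A)) ->
  \esum_(A in meets_fs L) (f A)%:E \is a fin_num.
Proof.
move=> f0 fle; rewrite ge0_fin_numE ?esum_ge0//.
by apply: le_lt_trans (esum_part_le _ fle) _; apply: le_lt_trans (esum_meets_le L) (ltry _).
Qed.

(** The positive and negative parts both lie between 0 and the bound, hence so does the absolute
    value of their difference, without a factor 2. *)
Lemma hamiltonian_le L s : (`|hamiltonian Phi L s| <= #|` L|%:R * inorm)%R.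
Proof.
rewrite /hamiltonian -/(posp s) -/(negp s).
have b (f : {fset site d} -> R) : (forall A, 0 <= (f A)%:E) ->
  (forall A, ((f A)%:E <= int_norm A)) ->
  (0 <= fine (\esum_(A in meets_fs L) (f A)%:E) <= #|` L|%:R * inorm)%R.
  move=> f0 fle; rewrite fine_ge0 ?esum_ge0//=.
  rewrite -lee_fin fineK ?part_fin//.
  exact: le_trans (esum_part_le _ fle) (esum_meets_le L).
have /andP[? ?] := b _ (posp_ge0 s) (posp_le s).
have /andP[? ?] := b _ (negp_ge0 s) (negp_le s).
rewrite ler_norml; apply/andP; split; lra.
Qed.

Lemma hamiltonian_quasilocal (L : {fset site d}) (del : R) : (0 < del)%R ->
  exists2 L' : {fset site d}, {subset L <= L'} &
    forall s s' : Omega d, (forall x, x \in L' -> s x = s' x) ->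
      (`|hamiltonian Phi L s - hamiltonian Phi L s'| <= del)%R.
Proof.
move=> del0; have d40 : (0 < del / 2)%R by rewrite divr_gt0.
have Sfin : \esum_(A in meets_fs L) int_norm A \is a fin_num.
  rewrite ge0_fin_numE; last by apply: esum_ge0 => A _; exact: int_norm_ge0.
  by apply: le_lt_trans (esum_meets_le L) _; rewrite ltry.
(* A finite family [F] carries the sum of norms up to [del / 2]. Configurations agreeing on its
   union have the same terms in [F]; the tails of the positive and of the negative parts then cost
   [del / 2] each. *)
have [_ [F [finF FL] <-] Fd] := ub_ereal_sup_adherent d40 Sfin.
exists (L `|` \bigcup_(A <- fset_set F) A)%fset.
  by move=> x xL; rewrite inE xL.
move=> s s' ss'.
have agree A : F A -> Phi A s = Phi A s'.
  move=> FA; apply: HL => x xA; apply: ss'; rewrite inE; apply/orP; right.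
  apply/bigfcupP; exists A => //.
  by rewrite andbT in_fset_set// inE.
have tail : \esum_(A in meets_fs L `&` ~` F) int_norm A <= (del / 2)%:E.
  have e := @esumID R _ F (meets_fs L) int_norm (fun A _ => int_norm_ge0 A).
  rewrite (setIidr FL) in e.
  have FE : \esum_(A in F) int_norm A = \sum_(A \in F) int_norm A.
    rewrite -(esum_fset (F := F))//; last by move=> *; exact: int_norm_ge0.
  have gen (a b c : \bar R) : a = b + c -> a \is a fin_num -> 0 <= b -> 0 <= c ->
      a - (del / 2)%:E < b -> c <= (del / 2)%:E.
    case: a b c => [a| |] // [b| |] // [c| |] //= [->] _ _ _.
    by rewrite -EFinB lte_fin lee_fin; lra.
  apply: gen e Sfin _ _ _.
  - by apply: esum_ge0 => *; exact: int_norm_ge0.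
  - by apply: esum_ge0 => *; exact: int_norm_ge0.
  - by rewrite FE.
have part (f g : {fset site d} -> R) : (forall A, 0 <= (f A)%:E) ->
  (forall A, ((f A)%:E <= int_norm A)) -> (forall A, 0 <= (g A)%:E) ->
  (forall A, ((g A)%:E <= int_norm A)) -> (forall A, F A -> f A = g A) ->
  (`|fine (\esum_(A in meets_fs L) (f A)%:E) -
     fine (\esum_(A in meets_fs L) (g A)%:E)| <= del / 2)%R.
  move=> f0 fle g0 gle fg.
  have := part_fin L f0 fle; have := part_fin L g0 gle.
  rewrite (@esumID R _ F (meets_fs L) (fun A => (f A)%:E) (fun A _ => f0 A)).
  rewrite (@esumID R _ F (meets_fs L) (fun A => (g A)%:E) (fun A _ => g0 A)).
  have -> : \esum_(i in meets_fs L `&` F) (f i)%:E = \esum_(i in meets_fs L `&` F) (g i)%:E.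
    by apply: eq_esum => A [_ FA]; rewrite fg.
  have tf := le_trans (esum_part_le _ fle) tail.
  have tg := le_trans (esum_part_le _ gle) tail.
  have tf0 : 0 <= \esum_(A in meets_fs L `&` ~` F) (f A)%:E by apply: esum_ge0.
  have tg0 : 0 <= \esum_(A in meets_fs L `&` ~` F) (g A)%:E by apply: esum_ge0.
  have h0 : 0 <= \esum_(A in meets_fs L `&` F) (g A)%:E by apply: esum_ge0.
  have gen (h a b : \bar R) : 0 <= h -> 0 <= a -> 0 <= b -> a <= (del / 2)%:E ->
      b <= (del / 2)%:E -> h + b \is a fin_num -> h + a \is a fin_num ->
      (`|fine (h + a) - fine (h + b)| <= del / 2)%R.
    case: h a b => [h| |] // [a| |] // [b| |] //=; rewrite ?lee_fin => *.
    rewrite opprD addrACA subrr add0r ler_norml; apply/andP; split; lra.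
  exact: gen.
have p1 := part _ _ (posp_ge0 s) (posp_le s) (posp_ge0 s') (posp_le s').
have p2 := part _ _ (negp_ge0 s) (negp_le s) (negp_ge0 s') (negp_le s').
rewrite /hamiltonian -/(posp s) -/(negp s) -/(posp s') -/(negp s').
have {}p1 := p1 (fun A FA => congr1 (fun x => (Num.max x 0)%R) (agree A FA)).
have {}p2 := p2 (fun A FA => congr1 (fun x => (Num.max (- x) 0)%R) (agree A FA)).
move: p1 p2; rewrite !ler_norml => /andP[? ?] /andP[? ?].
by apply/andP; split; lra.
Qed.

Lemma meets_fs_ftranslate x (L A : {fset site d}) :
  meets_fs (ftranslate x L) (ftranslate x A) <-> meets_fs L A.
Proof.
rewrite /meets_fs /=; split=> /fset0Pn[y]; rewrite inE => /andP[yA yL]; apply/fset0Pn.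
  by exists (sadd y (sopp x)); rewrite inE -!mem_ftranslate yA.
by exists (sadd y x); rewrite inE !mem_ftranslate saddK yA.
Qed.

Lemma hamiltonian_ftranslate x L s :
  hamiltonian Phi (ftranslate x L) s = hamiltonian Phi L (tshift x s).
Proof.
have bij : set_bij (meets_fs L) (meets_fs (ftranslate x L)) (ftranslate x).
  split=> [A /= LA|A B _ _ |A /= LA]; first exact/meets_fs_ftranslate.
    exact/can_inj/ftranslateK.
  exists (ftranslate (sopp x) A); last exact: ftranslateNK.
  by apply: (meets_fs_ftranslate x L (ftranslate (sopp x) A)).1; rewrite ftranslateNK; exact: LA.
by rewrite /hamiltonian !(reindex_esum _ _ _ _ bij); congr (fine _ - fine _)%R;
  apply: eq_esum => A _; rewrite -(HT A x s).
Qed.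

End hamiltonian_bounds.

(** * Finite energy and stationarity of a mixing Gibbs measure *)

Lemma sdist_leP d (x y : site d) k :
  reflect (forall i, (`|x i - y i| <= k)%N) (sdist x y <= k)%N.
Proof.
by apply: (iffP (bigmax_leqP _ _ _)) => h i; [apply: h | move=> _; apply: h].
Qed.

Lemma sdist_ge_coord d (x y : site d) i : (`|x i - y i| <= sdist x y)%N.
Proof. exact: (leq_bigmax i). Qed.

Lemma inC_emb d k (z : site d) : inC k z -> exists y : box d k, z = emb y.
Proof.
move=> zk; exists [ffun i => inord `|z i|%N]; apply/ffunP => i; rewrite !ffunE.
have := zk i; move: (z i) => [m|m] //= mk.
by rewrite inordK//; lia.
Qed.

Lemma emb_inC d k (y : box d k) : inC k (emb y).
Proof. by move=> i; rewrite ffunE; have := ltn_ord (y i); lia. Qed.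

Lemma emb_inj d k : injective (@emb d k).
Proof.
move=> y y' /ffunP yy'; apply/ffunP => i; apply: val_inj.
by have := yy' i; rewrite !ffunE => -[].
Qed.

Definition cubeS d k : {fset site d} := [fset emb y | y in {: box d k}]%fset.

Lemma mem_cubeS d k (z : site d) : reflect (inC k z) (z \in cubeS d k).
Proof.
apply: (iffP (imfsetP _ _ _ _)) => [[y _ ->]|/inC_emb[y ->]]; first exact: emb_inC.
by exists y.
Qed.

Lemma card_cubeS d k : #|` cubeS d k| = (k.+1 ^ d)%N.
Proof.
rewrite /cubeS card_imfset/=; last exact: emb_inj.
by rewrite -cardE card_ffun !card_ord.
Qed.

Lemma card_box d k : #|{: box d k}| = (k.+1 ^ d)%N.
Proof. by rewrite card_ffun !card_ord. Qed.

Lemma exists_collar d (A : {fset site d}) (m : nat) :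
  exists2 L : {fset site d}, {subset A <= L} &
    forall x y, x \in A -> y \notin L -> (m <= sdist x y)%N.
Proof.
exists (\bigcup_(a <- A) ftranslate (sadd a [ffun=> - m%:Z]) (cubeS d (m + m)))%fset.
  move=> a aA; apply/bigfcupP; exists a; first by rewrite aA.
  rewrite mem_ftranslate; apply/mem_cubeS => i; rewrite !ffunE; lia.
move=> x y xA /bigfcupP yL; rewrite leqNgt; apply/negP => /ltnW/sdist_leP xy.
apply: yL; exists x; first by rewrite xA.
rewrite mem_ftranslate; apply/mem_cubeS => i; rewrite !ffunE.
by have := xy i; lia.
Qed.

(** Multiplying out the conditional probability and the cardinality makes the inequality meaningful
    for null [E2] and for empty [A1], so later inductions need no case distinction. *)
Definition exp_mixing (R : realType) d (P : probability (Omega d) R) (C1 C2 : R) :=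
  forall (m : nat) (A1 A2 : {fset site d}) (E1 E2 : set (Omega d)), (0 < m)%N ->
  (forall x y, x \in A1 -> y \in A2 -> (m <= sdist x y)%N) ->
  depends_on A1 E1 -> depends_on A2 E2 ->
  `|pr P (E1 `&` E2) - pr P E1 * pr P E2| <=
    #|` A1|%:R * (C1 * expR (- C2 * m%:R)) * pr P E2.

Lemma exp_mixingP (R : realType) d (P : probability (Omega d) R) :
  nonunif_exp_phi_mixing P ->
  exists C1 C2 : R, [/\ 0 < C1, 0 < C2 & exp_mixing P C1 C2].
Proof.
move=> [C1 [C2 [C10 [C20 mix]]]]; exists C1, C2; split=> // m A1 A2 E1 E2 m0 sep d1 d2.
have mE1 := measurable_depends_on d1; have mE2 := measurable_depends_on d2.
have mE12 := measurableI _ _ mE1 mE2.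
have [E20|E20] := leP (pr P E2) 0.
  have e20 : pr P E2 = 0 by apply/eqP; rewrite eq_le E20 pr_ge0.
  have : pr P (E1 `&` E2) <= pr P E2 by rewrite setIC pr_leIl.
  rewrite e20 !mulr0 subr0 => h.
  by rewrite (_ : pr P _ = 0) ?normr0//; apply/eqP; rewrite eq_le h pr_ge0.
have -> : pr P (E1 `&` E2) - pr P E1 * pr P E2 =
    (pr P (E1 `&` E2) / pr P E2 - pr P E1) * pr P E2.
  by rewrite mulrBl divfK ?gt_eqF.
rewrite normrM (gtr0_norm E20) ler_pM2r//.
(* For empty [A1] the quotient in the hypothesis is a division by zero and says nothing; but then
   [E1] is trivial and the difference vanishes. *)
have [A0|A0] := posnP #|` A1|.
  have E01 : E1 = set0 \/ E1 = setT.
    have [[s Es]|nE] := pselect (exists s, E1 s); [right|left].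
      apply/seteqP; split=> // s' _; apply/(d1 s) => // x.
      by rewrite (cardfs0_eq A0) inE.
    by apply/seteqP; split=> // s Es; apply: nE; exists s.
  rewrite A0 mul0r; case: E01 => ->; first by rewrite set0I pr0 mul0r subrr normr0.
  by rewrite setTI prT divff ?gt_eqF// subrr normr0.
have := mix m%:R _ A1 A2 _ E1 E2 d1 d2.
rewrite -/(pr P _) -/(pr P E2) -/(pr P E1) ltr0n => /(_ m0).
rewrite (prE _ mE2) lte_fin => h.
have sepR x y : x \in A1 -> y \in A2 -> m%:R <= (sdist x y)%:R :> R.
  by move=> xA yA; rewrite ler_nat; exact: sep.
by move: (h sepR E20); rewrite ler_pdivrMr ?ltr0n// [X in _ <= X -> _]mulrC.
Qed.

Lemma expR_small (R : realType) (C1 C2 e : R) : 0 < C2 -> 0 < e -> exists2 m : nat, (0 < m)%N &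
  C1 * expR (- C2 * m%:R) <= e.
Proof.
move=> C20 e0; have [C10|C10] := leP C1 0.
  by exists 1%N => //; rewrite (le_trans _ (ltW e0))// mulr_le0_ge0// expR_ge0.
exists (Num.truncn (C1 / (C2 * e))).+1 => //.
have : C1 / (C2 * e) < (Num.truncn (C1 / (C2 * e))).+1%:R by exact: truncnS_gt.
set m := _.+1; rewrite ltr_pdivrMr ?mulr_gt0// => mC.
rewrite mulNr expRN ler_pdivrMr ?expR_gt0//.
rewrite (le_trans (ltW mC))// mulrCA mulrA mulrC ler_pM2l//.
by rewrite (le_trans _ (expR_ge1Dx _))// mulrC lerDr.
Qed.

(* Given the configuration [eta] on a large annulus around [L], [E] has conditional
   probability close to [gibbs_spec Phi L E eta] by quasilocality, and close to [P E]
   by mixing. *)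
Section specification.
Context (R : realType) (d : nat) (P : probability (Omega d) R).
Context (Phi : interaction R d).
Hypotheses (HL : local_interaction Phi) (HT : transl_invariant Phi)
  (HS : abs_summable Phi).
Hypothesis DLR : forall (L : {fset site d}) (B : set (Omega d)), measurable B ->
        P B = (\int[P]_eta (gibbs_spec Phi L B eta)%:E)%E.

Let W (L : {fset site d}) (xi : {ffun L -> bool}) eta := expR (- hamiltonian Phi L (glue_cfg xi eta)).
Let Z (L : {fset site d}) eta := \sum_(xi : {ffun L -> bool}) W xi eta.

Let Z_gt0 L eta : 0 < Z L eta.
Proof.
rewrite /Z (bigD1 [ffun=> false])//= ltr_pwDl ?expR_gt0//.
by apply: sumr_ge0 => xi _; exact: expR_ge0.
Qed.

Lemma gibbs_specE (L : {fset site d}) (B : set (Omega d)) eta :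
  gibbs_spec Phi L B eta =
  (\sum_(xi : {ffun L -> bool}) \1_B (glue_cfg xi eta) * W xi eta) / Z L eta.
Proof. by []. Qed.

Lemma gibbs_spec_ge0 L B eta : 0 <= gibbs_spec Phi L B eta.
Proof.
rewrite gibbs_specE divr_ge0 ?(ltW (Z_gt0 _ _))//; apply: sumr_ge0 => xi _.
by rewrite mulr_ge0 ?expR_ge0.
Qed.

Lemma gibbs_specC L B eta :
  gibbs_spec Phi L (~` B) eta = 1 - gibbs_spec Phi L B eta.
Proof.
have Z0 : Z L eta != 0 by rewrite gt_eqF.
rewrite !gibbs_specE; apply: (mulIf Z0); rewrite mulrBl mul1r !divfK//.
apply/eqP; rewrite eq_sym subr_eq -big_split/=; apply/eqP; apply: eq_bigr => xi _.
by rewrite -mulrDl !indicE in_setC; case: (_ \in B); rewrite ?(addr0, add0r) mul1r.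
Qed.

Lemma pr_ge_gibbs_spec L B F c : measurable B -> measurable F ->
  (forall eta, F eta -> c <= gibbs_spec Phi L B eta) -> c * pr P F <= pr P B.
Proof.
move=> mB mF cB; have [c0|c0] := leP 0 c; last first.
  by rewrite (le_trans _ (pr_ge0 P B))// mulr_le0_ge0 ?pr_ge0// ltW.
rewrite -lee_fin EFinM -!prE// (DLR L mB).
by apply: integral_ge_indic => // x; exact: gibbs_spec_ge0.
Qed.

(** Finite energy: with [c] the interaction norm, each weight lies between exp(- |L| c) and exp(|L|
    c), and the partition function has 2^|L| of them. *)
Lemma gibbs_spec_ge (L : {fset site d}) (B : set (Omega d)) eta (xi : {ffun L -> bool}) : B (glue_cfg xi eta) ->
  expR (- (#|` L|%:R * (2 * inorm Phi + ln 2))) <= gibbs_spec Phi L B eta.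
Proof.
move=> Bxi; set c := inorm Phi.
have Wge (x : {ffun L -> bool}) : expR (- (#|` L|%:R * c)) <= W x eta.
  rewrite ler_expR lerN2; apply: le_trans (ler_norm _) _.
  exact: hamiltonian_le.
have Wle (x : {ffun L -> bool}) : W x eta <= expR (#|` L|%:R * c).
  rewrite ler_expR lerNl; have := hamiltonian_le HT HS L (glue_cfg x eta).
  by rewrite ler_norml => /andP[].
rewrite gibbs_specE ler_pdivlMr// (bigD1 xi)//= indicE mem_set// mul1r.
rewrite (@le_trans _ _ (W xi eta))//; last first.
  rewrite lerDl; apply: sumr_ge0 => x _.
  by rewrite mulr_ge0 ?expR_ge0.
apply: le_trans (Wge xi).
have Zle : Z L eta <= expR (#|` L|%:R * (c + ln 2)).
  rewrite /Z (le_trans (ler_sum _ (fun x _ => Wle x)))//.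
  rewrite sumr_const card_ffun card_bool mulrDr expRD -[X in X <= _]mulr_natr.
  by rewrite ler_pM2l ?expR_gt0// expRM_natl lnK ?posrE// natrX cardfE.
apply: le_trans (ler_wpM2l (expR_ge0 _) Zle) _.
by rewrite -expRD ler_expR; lra.
Qed.

Definition agree_on (A : {fset site d}) (eta : Omega d) : set (Omega d) :=
  [set s | forall x, x \in A -> s x = eta x].

Lemma depends_agree_on A eta : depends_on A (agree_on A eta).
Proof.
move=> s s' ss'; rewrite /agree_on /=; split=> h x xA; first by rewrite -ss'// h.
by rewrite ss'// h.
Qed.

Lemma glue_in (L : {fset site d}) (xi : {ffun L -> bool}) (eta : Omega d) x (xL : x \in L) :
  glue_cfg xi eta x = xi [` xL]%fset.
Proof. by rewrite /glue_cfg insubT. Qed.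

Lemma glue_out (L : {fset site d}) (xi : {ffun L -> bool}) (eta : Omega d) x : x \notin L ->
  glue_cfg xi eta x = eta x.
Proof. by move=> xL; rewrite /glue_cfg insubN. Qed.

Lemma pr_agree_on_ge L eta :
  expR (- (#|` L|%:R * (2 * inorm Phi + ln 2))) <= pr P (agree_on L eta).
Proof.
have mA := measurable_depends_on (@depends_agree_on L eta).
have := @pr_ge_gibbs_spec L _ setT (expR (- (#|` L|%:R * (2 * inorm Phi + ln 2)))) mA measurableT.
rewrite prT mulr1; apply => w _.
apply: (gibbs_spec_ge (xi := [ffun x : L => eta (val x)])) => x xL.
by rewrite (glue_in _ _ xL) ffunE.
Qed.

(** Changing the boundary condition alters each weight by a factor within exp(- tau) and exp(tau),
    hence the normalised ratio loses at most the factor exp(- 2 tau) >= 1 - 2 tau; the ratio itself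
    is at most 1. *)
Lemma gibbs_spec_quasi (L : {fset site d}) (B : set (Omega d)) (tau : R) (w eta : Omega d) : 0 <= tau ->
  (forall xi : {ffun L -> bool}, B (glue_cfg xi eta) -> B (glue_cfg xi w)) ->
  (forall xi : {ffun L -> bool}, `|hamiltonian Phi L (glue_cfg xi w) -
     hamiltonian Phi L (glue_cfg xi eta)| <= tau) ->
  gibbs_spec Phi L B eta - 2 * tau <= gibbs_spec Phi L B w.
Proof.
move=> tau0 Bw Hw.
have Wge (x : {ffun L -> bool}) : expR (- tau) * W x eta <= W x w.
  by rewrite -expRD ler_expR; have := Hw x; rewrite ler_norml => /andP[]; lra.
have Wle (x : {ffun L -> bool}) : W x w <= expR tau * W x eta.
  by rewrite -expRD ler_expR; have := Hw x; rewrite ler_norml => /andP[]; lra.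
have key : expR (- (2 * tau)) * gibbs_spec Phi L B eta <= gibbs_spec Phi L B w.
  rewrite !gibbs_specE ler_pdivlMr//.
  have Zle : Z L w <= expR tau * Z L eta.
    by rewrite /Z mulr_sumr ler_sum.
  apply: le_trans (ler_wpM2l _ Zle) _.
    by rewrite mulr_ge0 ?expR_ge0// -gibbs_specE gibbs_spec_ge0.
  have -> : expR (- (2 * tau)) = expR (- tau) * expR (- tau).
    by rewrite -expRD; congr expR; lra.
  have ee : expR (- tau) * expR tau = 1 by rewrite -expRD addNr expR0.
  set S := \sum_(xi : {ffun L -> bool}) _ * W xi eta.
  have -> : expR (- tau) * expR (- tau) * (S / Z L eta) * (expR tau * Z L eta) =
    (expR (- tau) * expR tau) * (Z L eta / Z L eta) * (expR (- tau) * S) by ring.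
  rewrite ee divff ?gt_eqF// !mul1r mulr_sumr ler_sum// => x _.
  rewrite !indicE mulrCA; have [/set_mem/Bw xB|_] := boolP (_ eta \in B); last first.
    by rewrite mul0r mulr_ge0// ltW// expR_gt0.
  by rewrite mem_set// !mul1r.
apply: le_trans key.
have le1 : gibbs_spec Phi L B eta <= 1.
  by have := gibbs_spec_ge0 L (~` B) eta; rewrite gibbs_specC subr_ge0.
have := gibbs_spec_ge0 L B eta; have := expR_ge1Dx (- (2 * tau)).
move: (expR _) (gibbs_spec _ _ _ _) le1 => e g; nra.
Qed.

Lemma gibbs_spec_ftranslate x (L : {fset site d}) (B : set (Omega d)) eta :
  gibbs_spec Phi (ftranslate x L) (tshift x @^-1` B) eta =
  gibbs_spec Phi L B (tshift x eta).
Proof.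
have memx (z : ftranslate x L) : sadd (val z) (sopp x) \in L.
  by rewrite -mem_ftranslate (valP z).
pose h (xi : {ffun L -> bool}) : {ffun ftranslate x L -> bool} :=
  [ffun z => xi [` memx z]%fset].
have hinj : injective h.
  move=> a b /ffunP ab; apply/ffunP => y.
  have yx : sadd (val y) x \in ftranslate x L by rewrite mem_ftranslate saddK (valP y).
  have := ab [` yx]%fset; rewrite !ffunE.
  by rewrite (_ : [` memx _]%fset = y)//; apply: val_inj; rewrite /= saddK.
have hbij : bijective h.
  by apply: inj_card_bij => //; rewrite !card_ffun -!cardfE card_ftranslate.
have hglue xi : tshift x (glue_cfg (h xi) eta) = glue_cfg xi (tshift x eta).
  apply/funext => y; rewrite /tshift.
  have [yL|yL] := boolP (y \in L).
    have yx : sadd y x \in ftranslate x L by rewrite mem_ftranslate saddK.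
    rewrite (glue_in _ _ yx) (glue_in _ _ yL) ffunE; congr (xi _).
    by apply: val_inj; rewrite /= saddK.
  by rewrite !glue_out// mem_ftranslate saddK.
rewrite /gibbs_spec (reindex h)/=; last exact: onW_bij.
rewrite [X in _ / X](reindex h)/=; last exact: onW_bij.
congr (_ / _); apply: eq_bigr => xi _; rewrite (hamiltonian_ftranslate HT) hglue; last by [].
by rewrite !indicE; congr (_%:R * _); congr nat_of_bool; apply: asbool_equiv_eq; rewrite /= hglue.
Qed.

Context (C1 C2 : R) (C20 : 0 < C2) (mix : exp_mixing P C1 C2).

(** Integrating the specification only bounds probabilities from below. Applied to the complement of
    [E], this bounds the specification of the complement from above, which is the claim. That [L]
    serves all [eta] is what makes the translation argument possible. *)
Lemma gibbs_spec_ge_pr A E (e : R) : depends_on A E -> 0 < e ->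
  exists L : {fset site d}, forall eta, pr P E - e <= gibbs_spec Phi L E eta.
Proof.
move=> AE e0.
have e20 : 0 < e / 2 by rewrite divr_gt0.
have e40 : 0 < e / 4 by rewrite divr_gt0.
have [m m0 mC] := expR_small (#|` A|%:R * C1) C20 e20.
have [L AL Lm] := exists_collar A m.
have [L' LL' HL'] := hamiltonian_quasilocal HL HT HS L e40.
exists L => eta.
(* Conditioning on the annulus alone serves both purposes: its sites are far from [A], for mixing,
   and they fix the Hamiltonian of [L] up to [e / 4]. *)
pose F := agree_on (L' `\` L)%fset eta.
have dF : depends_on (L' `\` L)%fset F by exact: depends_agree_on.
have dE := depends_onC AE.
have mE := measurable_depends_on dE.
have mF := measurable_depends_on dF.
have F0 : 0 < pr P F by apply: lt_le_trans (pr_agree_on_ge _ _); exact: expR_gt0.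
have lower : (gibbs_spec Phi L (~` E) eta - 2 * (e / 4)) * pr P F <= pr P (~` E `&` F).
  apply: (pr_ge_gibbs_spec (L := L)) => //; first exact: measurableI.
  move=> w Fw.
  have Fglue (xi : {ffun L -> bool}) : F (glue_cfg xi w).
    by move=> x /[!inE] /andP[xL xL']; rewrite glue_out// Fw// !inE xL.
  have -> : gibbs_spec Phi L (~` E `&` F) w = gibbs_spec Phi L (~` E) w.
    rewrite !gibbs_specE; congr (_ / _); apply: eq_bigr => xi _; congr (_ * _).
    by rewrite !indicE in_setI (mem_set (Fglue xi)) andbT.
  apply: gibbs_spec_quasi => [|xi|xi]; first exact: ltW.
    move=> h; apply: ((dE (glue_cfg xi eta) (glue_cfg xi w) _).1 h) => x xA.
    by rewrite !(glue_in _ _ (AL _ xA)).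
  apply: HL' => x xL'; have [xL|xL] := boolP (x \in L).
    by rewrite !(glue_in _ _ xL).
  by rewrite !glue_out// Fw// !inE xL.
have sep x y : x \in A -> y \in (L' `\` L)%fset -> (m <= sdist x y)%N.
  by move=> xA /[!inE] /andP[yL _]; exact: Lm.
have mixE : pr P (~` E `&` F) / pr P F - pr P (~` E) <= e / 2.
  have := mix m0 sep dE dF; rewrite ler_norml => /andP[_].
  have := ler_wpM2r (ltW F0) mC; rewrite -[X in X * _ <= _ -> _]mulrA => h1 h2.
  rewrite lerBlDr ler_pdivrMr// mulrDl; lra.
move: lower; rewrite -ler_pdivlMr// gibbs_specC.
have := prC P (measurable_depends_on AE); lra.
Qed.

(** The lower bound on the specification is uniform in the boundary condition, so it survives
    translating both volume and event. Integrating it over [P] in the translated volume gives one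
    inequality; the complement gives the other. *)
Lemma pr_tshift A E x : depends_on A E -> pr P (tshift x @^-1` E) = pr P E.
Proof.
have dx B F : depends_on B F -> depends_on (ftranslate x B) (tshift x @^-1` F).
  move=> BF s s' ss'; apply: BF => y yB; apply: ss'.
  by rewrite mem_ftranslate saddK.
have ge B F : depends_on B F -> pr P F <= pr P (tshift x @^-1` F).
  move=> BF; apply/ler_addgt0Pr => e e0.
  have [L Le] := gibbs_spec_ge_pr BF e0.
  have mB : measurable (tshift x @^-1` F).
    exact: measurable_depends_on (dx _ _ BF).
  have := @pr_ge_gibbs_spec (ftranslate x L) _ setT (pr P F - e) mB measurableT.
  rewrite prT mulr1 lerBlDr; apply.
  by move=> eta _; rewrite gibbs_spec_ftranslate.
move=> AE; apply/eqP; rewrite eq_le (ge _ _ AE) andbT.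
have mE := measurable_depends_on AE.
have mxE := measurable_depends_on (dx _ _ AE).
have := ge _ _ (depends_onC AE).
by rewrite preimage_setC !prC// lerD2l lerN2.
Qed.

End specification.

(** * Mixing and concentration *)

Lemma sdistC d (x y : site d) : sdist x y = sdist y x.
Proof. by apply: eq_bigr => i _; rewrite distnC. Qed.

Definition stationary_local (R : realType) d (P : probability (Omega d) R) :=
  forall (A : {fset site d}) (E : set (Omega d)) (x : site d), depends_on A E ->
    pr P (tshift x @^-1` E) = pr P E.

(** Exponential moment of one centred Bernoulli variable. The centring uses the unconditional mean
    [mu], whereas the conditional parameter [pi] is only known to exceed [mu - phi]; the discrepancy
    costs [lam * phi]. *)
Lemma chernoff_step (R : realType) (lam mu phi pi : R) :
  0 <= lam -> 0 <= pi <= 1 -> mu - phi <= pi ->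
  pi * expR (- lam * (1 - mu)) + (1 - pi) * expR (lam * mu) <=
  expR (lam ^+ 2 + lam * phi).
Proof.
move=> lam0 /andP[pi0 pi1] mupi.
have -> : expR (- lam * (1 - mu)) = expR (- lam) * expR (lam * mu).
  by rewrite -expRD; congr expR; ring.
have eN : expR (- lam) <= 1 - lam + lam ^+ 2.
  have h : expR (- lam) * (1 + lam) <= 1.
    have e1 : expR (- lam) * expR lam = 1 by rewrite -expRD addNr expR0.
    by rewrite -[X in _ <= X]e1 ler_pM2l ?expR_gt0// expR_ge1Dx.
  have l1 : 0 < 1 + lam by rewrite ltr_pwDl.
  rewrite -(ler_pM2r l1) (le_trans h)// -subr_ge0.
  have -> : (1 - lam + lam ^+ 2) * (1 + lam) - 1 = lam ^+ 3 by ring.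
  exact: exprn_ge0.
have -> : pi * (expR (- lam) * expR (lam * mu)) + (1 - pi) * expR (lam * mu) =
  expR (lam * mu) * (1 - pi * (1 - expR (- lam))) by ring.
have h1 : 1 - pi * (1 - expR (- lam)) <= expR (- (pi * (lam - lam ^+ 2))).
  apply: le_trans (expR_ge1Dx _); rewrite lerD2l lerN2 ler_wpM2l//; lra.
apply: le_trans (ler_wpM2l (expR_ge0 _) h1) _.
rewrite -expRD ler_expR.
have : lam * (mu - phi) <= lam * pi by rewrite ler_wpM2l.
have : pi * lam ^+ 2 <= 1 * lam ^+ 2 by rewrite ler_wpM2r// sqr_ge0.
lra.
Qed.

Section chernoff.
Context (R : realType) (d : nat) (P : probability (Omega d) R).
Context (C1 C2 : R).
Hypothesis mix : exp_mixing P C1 C2.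
Context (I : choiceType) (pos : I -> site d) (v : I -> bool).

Definition mism (i : I) : set (Omega d) := [set w | w (pos i) != v i].

(** Positive when [w] mismatches less often than expected, so its upper tail is the lower tail of
    the Hamming distance. *)
Definition excess (s : seq I) (w : Omega d) : R :=
  \sum_(i <- s) (pr P (mism i) - (w (pos i) != v i)%:R).

Lemma depends_mism i : depends_on [fset pos i]%fset (mism i).
Proof. by move=> s s' ss'; rewrite /mism /= ss'// inE. Qed.

Lemma depends_excess s th :
  depends_on [fset pos i | i in s]%fset [set w | th <= excess s w].
Proof.
move=> w w' ww'; suff e : excess s w = excess s w' by rewrite /= e.
rewrite /excess !big_seq; apply: eq_bigr => i si.
by rewrite ww'//; apply/imfsetP; exists i.
Qed.

(* The induction reveals one site at a time: [E] is split according to the value at that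
   site, which shifts the threshold [th], so no integral is needed. *)
Lemma chernoff_seq (m : nat) (lam phi : R) : (0 < m)%N -> 0 <= lam ->
  C1 * expR (- C2 * m%:R) <= phi ->
  forall s (A2 : {fset site d}) (E : set (Omega d)) (th : R),
  pairwise (fun i j => m <= sdist (pos i) (pos j))%N s ->
  depends_on A2 E ->
  (forall i y, i \in s -> y \in A2 -> (m <= sdist (pos i) y)%N) ->
  pr P (E `&` [set w | th <= excess s w]) <=
  pr P E * expR ((size s)%:R * (lam ^+ 2 + lam * phi) - lam * th).
Proof.
move=> m0 lam0 Cphi; elim=> [|i s IH] A2 E th.
  move=> _ dE _; have mE := measurable_depends_on dE.
  rewrite mul0r sub0r; have [th0|th0] := leP th 0.
    apply: (@le_trans _ _ (pr P E)).
      apply: pr_leIl => //.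
      exact: measurable_depends_on (@depends_excess [::] th).
    rewrite ler_peMr ?pr_ge0// -expR0 ler_expR.
    by rewrite -mulrN mulr_ge0// oppr_ge0.
  rewrite (_ : _ `&` _ = set0) ?pr0 ?mulr_ge0 ?pr_ge0 ?expR_ge0//.
  apply/seteqP; split=> // x [_ /=]; rewrite /excess big_nil => /le_lt_trans.
  by move=> /(_ _ th0); rewrite ltxx.
rewrite pairwise_cons => /andP[/allP im pw] dE sep.
have mE := measurable_depends_on dE.
have dX := @depends_mism i; have mX := measurable_depends_on dX.
have mD t s' := measurable_depends_on (@depends_excess s' t).
set X := mism i in dX mX *; set mu := pr P X.
have iA : depends_on (pos i |` A2)%fset (E `&` X) /\
    depends_on (pos i |` A2)%fset (E `&` ~` X).
  have h1 : depends_on (pos i |` A2)%fset E.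
    by apply: depends_onS dE => x xA; rewrite !inE xA orbT.
  have h2 : depends_on (pos i |` A2)%fset X.
    by apply: depends_onS dX => x xA; rewrite !inE; rewrite inE in xA; rewrite xA.
  by split; apply: depends_onI => //; exact: depends_onC.
have sep' j y : j \in s -> y \in (pos i |` A2)%fset -> (m <= sdist (pos j) y)%N.
  move=> js /[!inE] /orP[/eqP ->|yA]; first by rewrite sdistC; exact: im.
  by apply: sep => //; rewrite inE js orbT.
have exc w : excess (i :: s) w = mu - (w (pos i) != v i)%:R + excess s w.
  by rewrite /excess big_cons.
have mED := measurableI _ _ mE (mD th (i :: s)).
rewrite (prID P mED mX).
have -> : E `&` [set w | th <= excess (i :: s) w] `&` X =
    (E `&` X) `&` [set w | th - mu + 1 <= excess s w].
  apply/seteqP; split=> w [[wE /=]].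
    by rewrite exc => h wX; split=> //; move: h; rewrite wX /=; lra.
  by move=> wX h; split=> //; split=> //=; rewrite exc wX /=; move: h; lra.
have -> : E `&` [set w | th <= excess (i :: s) w] `&` ~` X =
    (E `&` ~` X) `&` [set w | th - mu <= excess s w].
  apply/seteqP; split=> w [[wE /=]].
    rewrite exc => h wX; split=> //; move: h; move/negP/negbTE: wX => -> /=; lra.
  move=> wX h; split=> //; split=> //=; rewrite exc.
  by move/negP/negbTE: wX => -> /=; move: h; lra.
have := IH _ _ (th - mu + 1) pw iA.1 sep'.
have := IH _ _ (th - mu) pw iA.2 sep'.
set r := (size s)%:R * _.
have eX := prID P mE mX.
have X0 := pr_ge0 P (E `&` X); have XC0 := pr_ge0 P (E `&` ~` X).
have mixi : (mu - phi) * pr P E <= pr P (E `&` X).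
  have s1 x y : x \in [fset pos i]%fset -> y \in A2 -> (m <= sdist x y)%N.
    by rewrite inE => /eqP -> yA; apply: sep => //; rewrite mem_head.
  have := mix m0 s1 dX dE.
  rewrite cardfs1 mul1r setIC ler_norml => /andP[h _].
  have := ler_wpM2r (pr_ge0 P E) Cphi; rewrite -/mu in h; lra.
move: eX X0 XC0 mixi; set a := pr P (E `&` X); set b := pr P (E `&` ~` X).
set e := pr P E => eX a0 b0 mixi h1 h2.
apply: le_trans (lerD h2 h1) _.
have -> : r - lam * (th - mu + 1) = (r - lam * th) + (- lam * (1 - mu)) by ring.
have -> : r - lam * (th - mu) = (r - lam * th) + lam * mu by ring.
have -> : (size (i :: s))%:R * (lam ^+ 2 + lam * phi) - lam * th =
    (r - lam * th) + (lam ^+ 2 + lam * phi) by rewrite /r /= -natr1; ring.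
rewrite !(expRD (r - lam * th)) !mulrA [a * _]mulrC [b * _]mulrC [e * _]mulrC -!mulrA -mulrDr.
rewrite ler_pM2l ?expR_gt0//.
have [e0|e0] := eqVneq e 0.
  have -> : a = 0 by lra. 
  have -> : b = 0 by lra.
  by rewrite e0 !mul0r addr0.
have ep : 0 < e by rewrite lt_def e0; lra.
have := @chernoff_step R lam mu phi (a / e) lam0.
rewrite divr_ge0// ?(ltW ep)//= ler_pdivrMr// mul1r ler_pdivlMr// => h.
have {}h := h (_ : a <= e) mixi.
have {}h : a / e * expR (- lam * (1 - mu)) + (1 - a / e) * expR (lam * mu) <=
  expR (lam ^+ 2 + lam * phi) by apply: h; lra.
have -> : a * expR (- lam * (1 - mu)) + b * expR (lam * mu) =
  e * (a / e * expR (- lam * (1 - mu)) + (1 - a / e) * expR (lam * mu)).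
  rewrite (_ : b = e - a); last lra.
  by field.
by rewrite ler_pM2l.
Qed.

End chernoff.

Lemma pairwise_neq (T : eqType) (r : rel T) (s : seq T) : uniq s ->
  (forall i j, i \in s -> j \in s -> i != j -> r i j) -> pairwise r s.
Proof.
rewrite uniq_pairwise => us h; apply: (sub_in_pairwise (P := mem s)) us.
  by move=> i j /= si sj; exact: h.
exact/allP.
Qed.

Lemma modn_eq_dist (a b m : nat) : (a = b %[mod m])%N -> a != b ->
  (m <= `|a%:Z - b%:Z|)%N.
Proof.
move=> ab neq; have ea := divn_eq a m; have eb := divn_eq b m.
have ne : (a %/ m)%N != (b %/ m)%N.
  by apply: contra neq => /eqP q; apply/eqP; rewrite ea q ab -eb.
rewrite ea eb ab; move: ne; move: (a %/ m)%N (b %/ m)%N (b %% m)%N => q q' r ne.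
have [lt|lt|eq] := ltngtP q q'; [nia|nia|by rewrite eq eqxx in ne].
Qed.

Lemma pr_boole (R : realType) d (P : probability (Omega d) R) (T : eqType)
    (s : seq T) (F : T -> set (Omega d)) (E : set (Omega d)) :
  measurable E -> (forall i, measurable (F i)) ->
  (forall w, E w -> exists2 i, i \in s & F i w) ->
  pr P E <= \sum_(i <- s) pr P (F i).
Proof.
elim: s E => [|i s IH] E mE mF EF.
  rewrite big_nil (_ : E = set0) ?pr0//.
  by apply/seteqP; split=> // w /EF[].
rewrite big_cons (prID P mE (mF i)) lerD//; first by rewrite setIC pr_leIl.
apply: IH => // [|w [/EF[j]]].
  by apply: measurableI => //; exact: measurableC.
by rewrite inE => /orP[/eqP ->|js] Fj nF //; exists j.
Qed.

Section ball.
Context (R : realType) (d : nat).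

Lemma depends_ball n (A : patt d n) (eps : R) :
  depends_on (cubeS d n) (approx_ball A eps).
Proof.
move=> s s' ss'; rewrite /approx_ball /=.
suff -> : hamming s A = hamming s' A by [].
by apply: eq_bigr => y _; rewrite ss'//; apply/mem_cubeS; exact: emb_inC.
Qed.

Context (P : probability (Omega d) R) (C1 C2 : R).
Hypothesis mix : exp_mixing P C1 C2.

Definition mean_dist n (A : patt d n) : R := \sum_y pr P (mism (@emb d n) A y).

(** Sites in one residue class modulo [m] are [m]-separated, so [chernoff_seq] applies to each of
    the [m ^ d] classes. In the ball the total excess is at least del (n+1)^d, hence some class has
    at least the average [tau]; a union bound over classes finishes. *)
Lemma ball_chernoff n (A : patt d n) (m : nat) (lam phi eps del : R) (A2 : {fset site d}) E :
  (0 < m)%N -> 0 <= lam -> 0 <= phi -> C1 * expR (- C2 * m%:R) <= phi ->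
  (eps + del) * (n.+1 ^ d)%:R <= mean_dist A ->
  depends_on A2 E ->
  (forall x y, x \in cubeS d n -> y \in A2 -> (m <= sdist x y)%N) ->
  pr P (E `&` approx_ball A eps) <=
  pr P E * ((m ^ d)%:R * expR (((n %/ m).+1 ^ d)%:R * (lam ^+ 2 + lam * phi)
     - lam * (del * (n.+1 ^ d)%:R / (m ^ d)%:R))).
Proof.
move=> m0 lam0 phi0 Cphi mean dE sep.
pose cls (y : box d n) : {ffun 'I_d -> 'I_m} := [ffun i => Ordinal (ltn_pmod (y i) m0)].
pose sc c := [seq y <- enum {: box d n} | cls y == c].
set tau := del * _ / _.
have mE := measurable_depends_on dE.
have mB := measurable_depends_on (@depends_ball n A eps).
have mD s th := measurable_depends_on (@depends_excess _ _ P _ (@emb d n) A s th).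
have md0 : (0 : R) < (m ^ d)%:R by rewrite ltr0n expn_gt0 m0.
have cardc : #|{: {ffun 'I_d -> 'I_m}}| = (m ^ d)%N by rewrite card_ffun !card_ord.
have cover w : approx_ball A eps w -> exists c, tau <= excess P (@emb d n) A (sc c) w.
  move=> wA; apply/not_existsP => h.
  have {}h c : excess P (@emb d n) A (sc c) w < tau.
    by rewrite ltNge; apply/negP; exact: h.
  have tot : \sum_c excess P (@emb d n) A (sc c) w = mean_dist A - (hamming w A)%:R.
    rewrite /excess /mean_dist /hamming natr_sum -sumrB.
    rewrite [RHS](partition_big cls xpredT)//=.
    by apply: eq_bigr => c _; rewrite /sc big_filter big_enum_cond.
  have : \sum_c excess P (@emb d n) A (sc c) w <= \sum_(c : {ffun 'I_d -> 'I_m}) tau.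
    by apply: ler_sum => c _; exact: ltW.
  have c0 : {ffun 'I_d -> 'I_m} by exact: [ffun => Ordinal m0].
  have : \sum_c excess P (@emb d n) A (sc c) w < \sum_(c : {ffun 'I_d -> 'I_m}) tau.
    rewrite (bigD1 c0)//= [X in _ < X](bigD1 c0)//= ltr_leD//.
    by apply: ler_sum => c _; exact: ltW.
  rewrite sumr_const cardc -[X in _ < X -> _]mulr_natr /tau divfK ?gt_eqF// tot.
  move: wA; rewrite /approx_ball /= card_box => wA lt _.
  move: mean lt wA; rewrite mulrDl; lra.
have step c : pr P (E `&` [set w | tau <= excess P (@emb d n) A (sc c) w]) <=
    pr P E * expR (((n %/ m).+1 ^ d)%:R * (lam ^+ 2 + lam * phi) - lam * tau).
  have usc : uniq (sc c) by rewrite filter_uniq// enum_uniq.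
  have modE i j : i \in sc c -> j \in sc c -> forall k, (i k %% m = j k %% m)%N.
    rewrite !mem_filter => /andP[/eqP ic _] /andP[/eqP jc _] k.
    by move: ic; rewrite -jc => /ffunP/(_ k); rewrite !ffunE => -[].
  have pw : pairwise (fun i j : box d n => m <= sdist (emb i) (emb j))%N (sc c).
    apply: pairwise_neq => // i j si sj ij.
    have [k ijk] : exists k, i k != j k.
      apply/existsP; rewrite -negb_forall; apply: contra ij => /forallP ij.
      by apply/eqP/ffunP => k; exact/eqP/ij.
    apply: leq_trans (sdist_ge_coord _ _ k); rewrite !ffunE.
    exact: modn_eq_dist (modE _ _ si sj k) ijk.
  have szc : (size (sc c) <= (n %/ m).+1 ^ d)%N.
    pose q (y : box d n) : {ffun 'I_d -> 'I_(n %/ m).+1} := [ffun k => inord (y k %/ m)].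
    have qinj : {in sc c &, injective q}.
      move=> i j si sj /ffunP qij; apply/ffunP => k; apply: val_inj.
      have := qij k; rewrite !ffunE => /(congr1 val) /=.
      have le (y : box d n) : (y k %/ m < (n %/ m).+1)%N.
        by rewrite ltnS leq_div2r// -ltnS.
      by rewrite !inordK// => qk; rewrite (divn_eq (i k) m) qk (modE _ _ si sj k) -divn_eq.
    rewrite -(size_map q) -[X in (_ <= X ^ _)%N]card_ord -[X in (_ <= _ ^ X)%N]card_ord.
    rewrite -card_ffun cardE; apply: uniq_leq_size; first by rewrite map_inj_in_uniq.
    by move=> y _; rewrite mem_enum.
  apply: le_trans (chernoff_seq mix A m0 lam0 Cphi _ pw dE _) _.
    by move=> i y _ yA; apply: sep => //; apply/mem_cubeS; exact: emb_inC.
  rewrite ler_wpM2l ?pr_ge0// ler_expR lerD2r ler_wpM2r ?ler_nat//.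
  by rewrite addr_ge0 ?sqr_ge0// mulr_ge0.
apply: (@le_trans _ _ (\sum_(c <- enum {: {ffun 'I_d -> 'I_m}})
    pr P (E `&` [set w | tau <= excess P (@emb d n) A (sc c) w]))).
  apply: pr_boole.
  - exact: measurableI.
  - by move=> c; apply: measurableI.
  - by move=> w [wE /cover[c wc]]; exists c => //; rewrite mem_enum.
rewrite big_enum; apply: le_trans (ler_sum _ (fun c _ => step c)) _.
by rewrite sumr_const cardc -[X in X <= _]mulr_natr -mulrA [expR _ * _]mulrC.
Qed.
End ball.

(** * Good patterns are far from every configuration on average *)

(** A count that is everywhere at least [c] on [E] has at least that mean. Splitting on the first
    event and lowering the threshold where it occurs replaces the expectation by an induction on
    probabilities. *)
Lemma pr_count_ge (R : realType) d (P : probability (Omega d) R) (T : Type)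
    (F : T -> set (Omega d)) (s : seq T) (E : set (Omega d)) (c : R) :
  measurable E -> (forall i, measurable (F i)) ->
  (forall w, E w -> c <= \sum_(i <- s) \1_(F i) w) ->
  c * pr P E <= \sum_(i <- s) pr P (E `&` F i).
Proof.
move=> + mF; elim: s E c => [|i s IH] E c mE cE.
  rewrite big_nil; have [[w Ew]|nE] := pselect (exists w, E w).
    by have := cE w Ew; rewrite big_nil => c0; rewrite mulr_le0_ge0 ?pr_ge0.
  rewrite (_ : E = set0) ?pr0 ?mulr0//.
  by apply/seteqP; split=> // w Ew; case: nE; exists w.
rewrite big_cons.
have mFi := mF i; have mEF := measurableI _ _ mE mFi.
have mEF' := measurableI _ _ mE (measurableC mFi).
have h1 := IH _ (c - 1) mEF; have h2 := IH _ c mEF'.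
have {}h1 : (c - 1) * pr P (E `&` F i) <= \sum_(j <- s) pr P (E `&` F i `&` F j).
  apply: h1 => w [Ew Fw]; have := cE w Ew.
  by rewrite big_cons indicE mem_set//= -lerBlDl.
have {}h2 : c * pr P (E `&` ~` F i) <= \sum_(j <- s) pr P (E `&` ~` F i `&` F j).
  apply: h2 => w [Ew Fw]; have := cE w Ew.
  by rewrite big_cons indicE memNset//= add0r.
have e : \sum_(j <- s) pr P (E `&` F j) =
  \sum_(j <- s) pr P (E `&` F i `&` F j) + \sum_(j <- s) pr P (E `&` ~` F i `&` F j).
  rewrite -big_split; apply: eq_bigr => j _ /=.
  by rewrite (prID P (measurableI _ _ mE (mF j)) mFi) setIAC [X in _ + pr P X]setIAC.
by rewrite e (prID P mE mFi); lra.
Qed.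

Section disagreement.
Context (d : nat).

Definition inCb (n : nat) (z : site d) := [forall i, (0 <= z i) && (z i <= n%:Z)].

Lemma inCP n z : reflect (inC n z) (inCb n z).
Proof. by apply: (iffP forallP) => h i; exact: h. Qed.

(** Meaningful only inside the box, since [inord] returns a filler elsewhere; this is why uses are
    guarded by [inCb] or [inC]. *)
Definition unemb n (z : site d) : box d n := [ffun i => inord `|z i|%N].

Lemma unembK n z : inC n z -> emb (unemb n z) = z.
Proof.
move=> zn; apply/ffunP => i; rewrite !ffunE.
by have := zn i; case: (z i) => [k|k] /= h; rewrite ?inordK//; lia.
Qed.

Lemma embK n : cancel (@emb d n) (unemb n).
Proof. by move=> y; apply: emb_inj; rewrite unembK//; exact: emb_inC. Qed.

(** Only the overlap of the box with its translate counts: elsewhere at most one of the two copies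
    of the pattern imposes a constraint. *)
Definition disagree n (A : patt d n) (x : site d) : {set box d n} :=
  [set y | inCb n (sadd (emb y) x) && (A y != A (unemb n (sadd (emb y) x)))].

Lemma hamming_card n (w : Omega d) (A : patt d n) :
  hamming w A = #|[set y | w (emb y) != A y]%SET|.
Proof.
rewrite /hamming -sum1dep_card [RHS]big_mkcond.
by apply: eq_bigr => y _; case: (_ != _).
Qed.

(* Otherwise a configuration following [A] on half of the disagreement sites and the
   translate of [A] on the other half is within [eps] of both. *)
Lemma good_disagree (R : realType) n (A : patt d n) (eps alpha : R) (x : site d) :
  good eps alpha A -> (0 < sdist x (sorigin d))%N ->
  (sdist x (sorigin d))%:R <= alpha * n%:R ->
  2 * (eps * (n.+1 ^ d)%:R) - 1 <= #|disagree A x|%:R.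
Proof.
move=> gA x0 xn; rewrite leNgt; apply/negP => lt.
set D := disagree A x in lt.
(* Half of [D], rounded down. The other half may have one site more, which is the origin of the
   [- 1] in the bound. *)
pose H : {set box d n} := [set y in take #|D|./2 (enum D)].
have HD : H \subset D.
  by apply/fintype.subsetP => y; rewrite inE => /mem_take; rewrite mem_enum.
have cH : #|H| = #|D|./2.
  rewrite /H cardsE; have /card_uniqP -> : uniq (take #|D|./2 (enum D)).
    by rewrite take_uniq// enum_uniq.
  by rewrite size_take -cardE; have := leq_half_double; case: ifP => // /negbT; lia.
(* On the translate of [H] the configuration follows the translated pattern, paying |H| mismatches
   with the original; on the rest of the box it follows the original, so the translated copy pays
   only on [D] minus [H]. *)
pose w : Omega d := fun z => let y := sadd z (sopp x) in
  if inCb n z && ~~ (inCb n y && (unemb n y \in H)) then A (unemb n z)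
  else A (unemb n y).
have c1 : (hamming w A <= #|H|)%N.
  rewrite hamming_card; set U := [set _ | _]%SET.
  pose q (u : box d n) := unemb n (sadd (emb u) (sopp x)).
  have UE u : u \in U -> inCb n (sadd (emb u) (sopp x)) && (q u \in H).
    rewrite inE /w /= (introT (inCP _ _) (emb_inC u)) /= embK -/(q u).
    by case: (_ && _); rewrite //= eqxx.
  have qinj : {in U &, injective q}.
    move=> u u' /UE/andP[/inCP h _] /UE/andP[/inCP h' _] /(congr1 (@emb d n)).
    by rewrite !unembK// => /(can_inj (saddNK x))/emb_inj.
  rewrite -(card_in_imset qinj) subset_leq_card//.
  by apply/fintype.subsetP => _ /imsetP[u /UE/andP[_ qH] ->].
have c2 : (hamming (tshift x w) A <= #|D :\: H|)%N.
  rewrite hamming_card subset_leq_card//; apply/fintype.subsetP => y; rewrite !inE.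
  rewrite /tshift /w /= saddK embK (introT (inCP _ _) (emb_inC y)) /=.
  case: (boolP (y \in H)) => yH; first by rewrite andbF eqxx.
  rewrite inE in yH; rewrite yH andbT /=.
  by case: ifP => [_|_]; rewrite ?eqxx//= eq_sym.
have HDc : (#|D :\: H| + #|H| = #|D|)%N by rewrite addnC -(cardsID H D) (finset.setIidPr HD).
have hD := odd_double_half #|D|; rewrite -cH in hD.
have oD : (odd #|D| <= 1)%N by case: odd.
rewrite -addnn in hD.
have b1 : #|H|%:R <= eps * (n.+1 ^ d)%:R.
  have : (#|H| + #|H| <= #|D|)%N by lia.
  by rewrite -(ler_nat R) natrD; lra.
have b2 : #|D :\: H|%:R <= eps * (n.+1 ^ d)%:R.
  have : (#|D :\: H| + #|D :\: H| <= #|D| + 1)%N by lia.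
  by rewrite -(ler_nat R) !natrD; lra.
have : (approx_ball A eps `&` (tshift x @^-1` approx_ball A eps)) w.
  by split; rewrite /approx_ball /= card_box; [apply: le_trans b1|apply: le_trans b2];
    rewrite ler_nat.
by rewrite gA.
Qed.
End disagreement.

Section plotkin.
Context (R : realType) (d n b : nat) (A : patt d n) (w : Omega d).

(** Records whether the copy of the pattern placed at [x] mismatches [w] at [z]. All copies are
    compared on the common box of side n + b, with value [false] off their own box. *)
Let f (x : box d b) (z : box d (n + b)) : bool :=
  inCb n (sadd (emb z) (sopp (emb x))) &&
  (w (emb z) != A (unemb n (sadd (emb z) (sopp (emb x))))).

Lemma sum_bool_card (T : finType) (p : pred T) : (\sum_x p x = #|[set x | p x]%SET|)%N.
Proof.
rewrite -sum1dep_card [RHS]big_mkcond.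
by apply: eq_bigr => y _; case: (p y).
Qed.

Let f_hamming x : (\sum_z f x z <= hamming (tshift (emb x) w) A)%N.
Proof.
rewrite hamming_card sum_bool_card; set U := [set _ | _]%SET.
pose q (z : box d (n + b)) := unemb n (sadd (emb z) (sopp (emb x))).
have UE z : z \in U -> inC n (sadd (emb z) (sopp (emb x))) /\ (w (emb z) != A (q z)).
  by rewrite inE /f => /andP[/inCP ? ?].
have qinj : {in U &, injective q}.
  move=> u u' /UE[h _] /UE[h' _] /(congr1 (@emb d n)).
  by rewrite !unembK// => /(can_inj (saddNK _))/emb_inj.
rewrite -(card_in_imset qinj) subset_leq_card//.
apply/fintype.subsetP => _ /imsetP[z /UE[h wz] ->].
by rewrite inE /tshift unembK// saddNK.
Qed.

Let f_disagree x x' :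
  (#|disagree A (sadd (emb x) (sopp (emb x')))| <= \sum_z (f x z != f x' z))%N.
Proof.
rewrite sum_bool_card.
pose q (y : box d n) := unemb (n + b) (sadd (emb y) (emb x)).
have qC (y : box d n) : inC (n + b) (sadd (emb y) (emb x)).
  by move=> i; have := emb_inC y i; have := emb_inC x i; rewrite !ffunE; lia.
have qinj : injective q.
  move=> y y' /(congr1 (@emb d _)); rewrite !unembK// => /(can_inj (saddK _)).
  exact: emb_inj.
rewrite -(card_imset _ qinj) subset_leq_card//.
apply/fintype.subsetP => _ /imsetP[y yD ->]; rewrite inE /f unembK// saddK embK.
rewrite (introT (inCP _ _) (emb_inC y)) /= -saddA.
move: yD; rewrite inE => /andP[-> /=].
by case: (w _); case: (A y); case: (A (unemb _ _)).
Qed.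

Let pairs z : (\sum_x \sum_x' (f x z != f x' z) =
  2 * ((\sum_x f x z) * (#|{: box d b}| - \sum_x f x z)))%N.
Proof.
set m := (\sum_x f x z)%N; set M := #|_|.
have mC : (\sum_x ~~ f x z = M - m)%N.
  have : (\sum_x ~~ f x z + m = M)%N.
    by rewrite -big_split/= /M -sum1_card; apply: eq_big => // x _; case: (f x z).
  by move=> <-; rewrite addnK.
have step x : (\sum_x' (f x z != f x' z) = f x z * (M - m) + ~~ f x z * m)%N.
  case fx : (f x z); rewrite /= ?mul1n ?mul0n ?addn0 ?add0n -?mC /m;
  by apply: eq_bigr => x' _; case: (f x' z).
under eq_bigr do rewrite step.
by rewrite big_split/= -!big_distrl/= mC -/m mul2n -addnn; congr (_ + _)%N; rewrite mulnC.
Qed.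

(* [m (M - m)] counts the ordered disagreeing pairs at a site where [m] of the [M]
   translates differ from [w]; Cauchy-Schwarz enters as [m ^ 2 >= 2 beta M m - beta ^ 2 M ^ 2]. *)
Lemma plotkin (eps alpha beta : R) : good eps alpha A -> b%:R <= alpha * n%:R ->
  let M : R := (b.+1 ^ d)%:R in
  0 <= beta -> beta <= 1 / 2 -> 0 <= 2 * (eps * (n.+1 ^ d)%:R) - 1 ->
  M * (M - 1) * (2 * (eps * (n.+1 ^ d)%:R) - 1) <=
  2 * (M * (1 - 2 * beta) * (\sum_(x : box d b) hamming (tshift (emb x) w) A)%:R
       + beta ^+ 2 * M ^+ 2 * ((n + b).+1 ^ d)%:R).
Proof.
move=> gA ba M beta0 beta1 D0; set D := 2 * _ - 1 in D0 *.
have cM : #|{: box d b}|%:R = M :> R by rewrite card_box.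
have low (x x' : box d b) : x' != x -> D <= (\sum_z (f x z != f x' z))%:R.
  move=> xx'; apply: (@le_trans _ _ #|disagree A (sadd (emb x) (sopp (emb x')))|%:R); last first.
    by rewrite ler_nat.
  apply: (good_disagree gA).
    rewrite lt0n; apply: contra xx' => /eqP s0; apply/eqP/ffunP => i.
    apply: val_inj; have := sdist_ge_coord (sadd (emb x) (sopp (emb x'))) (sorigin d) i.
    by rewrite s0 !ffunE subr0 /=; lia.
  apply: le_trans ba; rewrite ler_nat; apply/sdist_leP => i; rewrite !ffunE.
  by have := ltn_ord (x i); have := ltn_ord (x' i); lia.
have lhs : M * (M - 1) * D <= (\sum_x \sum_x' \sum_z (f x z != f x' z))%:R.
  have -> : M * (M - 1) * D = \sum_(x : box d b) (M - 1) * D.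
    by rewrite sumr_const -[RHS]mulr_natl cM mulrA.
  rewrite natr_sum ler_sum// => x _; rewrite natr_sum (bigD1 x)//=.
  rewrite -[leLHS]add0r lerD// (@le_trans _ _ (\sum_(x' | x' != x) D))//; last first.
    by apply: ler_sum => x' /low.
  rewrite sumr_const -[leRHS]mulr_natl ler_wpM2r//.
  by rewrite (@eq_card _ _ (predC1 x))// cardC1 card_box -subn1 natrB// expn_gt0.
apply: le_trans lhs _.
under eq_bigr do rewrite exchange_big/=.
rewrite exchange_big/=; under eq_bigr do rewrite pairs.
rewrite natr_sum.
have zstep z : (2 * ((\sum_x f x z) * (#|{: box d b}| - \sum_x f x z)))%:R <=
    2 * (M * (1 - 2 * beta) * (\sum_x f x z)%:R + beta ^+ 2 * M ^+ 2).
  set m := (\sum_x f x z)%N.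
  have mM : (m <= #|{: box d b}|)%N.
    by rewrite /m sum_bool_card max_card.
  rewrite !natrM natrB// cM.
  have : 0 <= (m%:R - beta * M) ^+ 2 by exact: sqr_ge0.
  nra.
apply: le_trans (ler_sum _ (fun z _ => zstep z)) _.
rewrite -mulr_sumr ler_pM2l// big_split/= -mulr_sumr sumr_const card_box.
rewrite -[X in _ + X]mulr_natr lerD2r ler_wpM2l//.
  by rewrite mulr_ge0//; lra.
by rewrite -natr_sum ler_nat exchange_big/= leq_sum.
Qed.

End plotkin.

Lemma eventually_ge_nat (R : realType) (x : R) :
  exists n0 : nat, forall n, (n0 <= n)%N -> x <= n%:R.
Proof.
exists (Num.truncn x).+1 => n n0n; apply: ltW.
by apply: lt_le_trans (truncnS_gt x) _; rewrite ler_nat.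
Qed.

Lemma leq_expn_d n d : (0 < d)%N -> (n.+1 <= n.+1 ^ d)%N.
Proof. by case: d => // d _; rewrite expnS leq_pmulr// expn_gt0. Qed.

Lemma leq_expn_double n b d : (b <= n)%N ->
  ((n + b).+1 ^ d <= 2 ^ d * n.+1 ^ d)%N.
Proof.
move=> bn; rewrite -expnMn; case: d => // d.
by rewrite leq_exp2r//; lia.
Qed.

Section mean.
Context (R : realType) (d : nat) (P : probability (Omega d) R).
Hypotheses (d0 : (0 < d)%N) (stat : stationary_local P).

(** The pointwise bound on the total distance passes to expectations, where by stationarity each of
    the (b+1)^d translates contributes the same [mean_dist]. *)
Lemma mean_dist_count n b (A : patt d n) (c : R) :
  (forall w, c <= (\sum_(x : box d b) hamming (tshift (emb x) w) A)%:R) ->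
  c <= (b.+1 ^ d)%:R * mean_dist P A.
Proof.
move=> cw.
pose F (xy : box d b * box d n) : set (Omega d) :=
  tshift (emb xy.1) @^-1` mism (@emb d n) A xy.2.
have depF xy : depends_on [fset sadd (emb xy.2) (emb xy.1)]%fset (F xy).
  by move=> s s' ss'; rewrite /F /mism /= /tshift ss'// inE.
have mF xy : measurable (F xy) := measurable_depends_on (depF xy).
have := @pr_count_ge R d P _ F (enum {: box d b * box d n}) setT c measurableT mF.
rewrite prT mulr1 => h; apply: (le_trans (h _)).
  move=> w _; apply: le_trans (cw w) _; rewrite big_enum/=.
  have -> : \sum_(xy : box d b * box d n) (\1_(F xy) w : R) =
      \sum_(x : box d b) \sum_(y : box d n) (\1_(F (x, y)) w : R).
    transitivity (\sum_(p : box d b * box d n) (\1_(F (p.1, p.2)) w : R)).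
      by apply: eq_bigr => -[].
    apply: esym; exact: (pair_bigA _ (fun x y => \1_(F (x, y)) w : R)).
  rewrite natr_sum ler_sum// => x _; rewrite natr_sum ler_sum// => y _.
  rewrite indicE /F /mism /= -[tshift _ w (emb y)]/(w _).
  by case: (boolP (_ != _)) => // neq; rewrite mem_set.
rewrite big_enum/=.
have -> : \sum_(xy : box d b * box d n) pr P (setT `&` F xy) =
    \sum_(x : box d b) \sum_(y : box d n) pr P (F (x, y)).
  by rewrite pair_bigA; apply: eq_bigr => -[x y] _; rewrite setTI.
under eq_bigr => x _ do under eq_bigr => y _ do
  rewrite /F (stat _ (@depends_mism d _ (@emb d n) A y)).
by rewrite sumr_const card_box mulr_natl.
Qed.

Lemma good_mean (eps alpha : R) : 0 < eps < 1 -> 0 < alpha ->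
  exists2 del : R, 0 < del & exists n0 : nat, forall n (A : patt d n), (n0 <= n)%N ->
  good eps alpha A -> (eps + del) * (n.+1 ^ d)%:R <= mean_dist P A.
Proof.
move=> /andP[eps0 eps1] al0.
(* To leading order the Plotkin bound divided by M^2 N gives a mean of (eps - beta^2 2^d) / (1 - 2
   beta), about eps + 2 eps beta - beta^2 2^d. The choice beta = eps / 2^d maximises this, with gain
   [g]; a quarter of [g] is kept as [del] and the rest absorbs lower-order terms. *)
pose be : R := eps / 2 ^+ d; pose g := eps * be.
have t0 : (0 : R) < 2 ^+ d by rewrite exprn_gt0.
have t2 : (2 : R) <= 2 ^+ d.
  by rewrite -[leLHS]expr1 ler_eXn2l// ltr1n.
have be0 : 0 < be by rewrite divr_gt0.
have g0 : 0 < g by rewrite mulr_gt0.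
have be1 : be < 1 / 2.
  rewrite /be ltr_pdivrMr// (lt_le_trans eps1)//.
  by move: t2; move: (2 ^+ d) => x; lra.
have bsq : be ^+ 2 * 2 ^+ d = g.
  by rewrite /g expr2 -mulrA /be divfK ?gt_eqF// mulrC.
(* The number of translates is fixed independently of [n], just large enough that replacing M by M -
   1 costs less than the gain; their distances stay below [alpha * n] once [n] is large. *)
have [b hb] := eventually_ge_nat (4 / be).
pose M : R := (b.+1 ^ d)%:R.
have M0 : 0 < M by rewrite ltr0n expn_gt0.
have Mb : 4 / be <= M.
  apply: le_trans (hb b (leqnn _)) _; rewrite ler_nat.
  exact: leq_trans (leqnSn _) (leq_expn_d _ d0).
have M1 : 4 <= be * M by rewrite -ler_pdivrMl// mulrC.
exists (g / 4); first by rewrite divr_gt0.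
have [n1 h1] := eventually_ge_nat (2 / g).
have [n2 h2] := eventually_ge_nat (b%:R / alpha).
exists (maxn b (maxn n1 n2)) => n A; rewrite !geq_max => /andP[bn /andP[/h1 n1n /h2 n2n]] gA.
set N : R := (n.+1 ^ d)%:R.
have N1 : 2 <= g * N.
  rewrite -ler_pdivrMl// mulrC (le_trans n1n)// ler_nat.
  exact: leq_trans (leqnSn _) (leq_expn_d _ d0).
have ge : g <= eps by rewrite /g ler_piMr// ltW//; lra.
have N0 : 0 < N by rewrite ltr0n expn_gt0.
have gN : g * N <= eps * N by rewrite ler_pM2r.
have ban : b%:R <= alpha * n%:R by rewrite -ler_pdivrMl// mulrC.
have D0 : 0 <= 2 * (eps * (n.+1 ^ d)%:R) - 1 by rewrite -/N; lra.
have Zle : ((n + b).+1 ^ d)%:R <= 2 ^+ d * N.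
  have := leq_expn_double d bn.
  by rewrite -(ler_nat R) natrM [(2 ^ d)%:R]natrX.
pose c : R := (M * (M - 1) * (2 * (eps * N) - 1) / 2 - be ^+ 2 * M ^+ 2 * (2 ^+ d * N))
  / (M * (1 - 2 * be)).
have den0 : 0 < M * (1 - 2 * be) by rewrite mulr_gt0//; lra.
have /mean_dist_count : forall w,
    c <= (\sum_(x : box d b) hamming (tshift (emb x) w) A)%:R.
  move=> w; rewrite /c ler_pdivrMr//.
  have := plotkin w gA ban (ltW be0) (ltW be1) D0.
  rewrite -/M -/N => h.
  have : be ^+ 2 * M ^+ 2 * ((n + b).+1 ^ d)%:R <= be ^+ 2 * M ^+ 2 * (2 ^+ d * N).
    by rewrite ler_wpM2l// mulr_ge0// sqr_ge0.
  lra.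
rewrite /c ler_pdivrMr// -/M => h.
have -> : mean_dist P A = (M * mean_dist P A * (M * (1 - 2 * be))) / (M ^+ 2 * (1 - 2 * be)).
  by field; apply/andP; split; apply/eqP; lra.
rewrite ler_pdivlMr; last by rewrite mulr_gt0 ?exprn_gt0//; lra.
apply: le_trans h.
have -> : be ^+ 2 * M ^+ 2 * (2 ^+ d * N) = M * (M * (g * N)) by rewrite -bsq; ring.
have -> : (eps + g / 4) * N * (M ^+ 2 * (1 - 2 * be)) =
  M * (M * ((eps + g / 4) * N * (1 - 2 * be))) by ring.
have -> : M * (M - 1) * (2 * (eps * N) - 1) / 2 - M * (M * (g * N)) =
  M * ((M - 1) * (eps * N - 1 / 2) - M * (g * N)) by field.
rewrite ler_pM2l//.
have -> : (M - 1) * (eps * N - 1 / 2) - M * (g * N) =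
  M * (eps * N - 1 / 2 - g * N) - (eps * N - 1 / 2) by ring.
have e1 : 4 * (eps * N) <= M * (g * N).
  have -> : M * (g * N) = (be * M) * (eps * N) by rewrite /g; ring.
  by rewrite ler_pM2r// mulr_gt0.
have e2 : M * ((eps + g / 4) * N * (1 - 2 * be)) <= M * (eps * N - 2 * (g * N) + g * N / 4).
  rewrite ler_pM2l//.
  have -> : (eps + g / 4) * N * (1 - 2 * be) =
    eps * N - 2 * (g * N) + g * N / 4 - be * (g * N) / 2 by rewrite /g; field.
  have : 0 <= be * (g * N) by rewrite !mulr_ge0// ltW.
  lra.
apply: le_trans e2 _.
have : M * (eps * N - 2 * (g * N) + g * N / 4) <= M * (eps * N - 1 / 2 - g * N) - M * (g * N) / 4.
  rewrite -subr_ge0.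
  have -> : M * (eps * N - 1 / 2 - g * N) - M * (g * N) / 4 -
    M * (eps * N - 2 * (g * N) + g * N / 4) = M * (g * N / 2 - 1 / 2) by field.
  by rewrite mulr_ge0// ?ltW//; lra.
lra.
Qed.

End mean.

Lemma pattern_class_bound (n m d : nat) : (0 < m)%N -> (m <= n.+1)%N ->
  ((n %/ m).+1 ^ d * m ^ d <= 2 ^ d * n.+1 ^ d)%N.
Proof.
move=> m0 mn; rewrite -!expnMn.
have : ((n %/ m).+1 * m <= 2 * n.+1)%N.
  have := leq_divM n m; lia.
by case: d => // d; rewrite leq_exp2r.
Qed.

Lemma ball_exp_small (R : realType) (d : nat) (P : probability (Omega d) R)
    (C1 C2 eps del : R) : (0 < d)%N -> exp_mixing P C1 C2 -> 0 < C2 -> 0 < del ->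
  exists kap : R, exists m n0 : nat, [/\ 0 < kap, (0 < m)%N &
  forall n (A : patt d n), (n0 <= n)%N ->
    (eps + del) * (n.+1 ^ d)%:R <= mean_dist P A ->
    forall A2 E, depends_on A2 E ->
      (forall x y, x \in cubeS d n -> y \in A2 -> (m <= sdist x y)%N) ->
      pr P (E `&` approx_ball A eps) <= pr P E * expR (- kap * (n.+1 ^ d)%:R)].
Proof.
move=> d0 mix C20 del0.
have t0 : (0 : R) < 2 ^+ d by rewrite exprn_gt0.
(* Taking [lam] also as the mixing error, the exponent gains 4 kap N from the deviation and loses 2
   kap N to the quadratic terms and kap N to the number of classes, which leaves - kap N. The
   separation [m] does not grow with [n]. *)
pose lam : R := del / (4 * 2 ^+ d).
have lam0 : 0 < lam by rewrite divr_gt0// mulr_gt0.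
have lt : 2 ^+ d * lam = del / 4 by rewrite /lam; field; rewrite gt_eqF.
have [m m0 mC] := expR_small C1 C20 lam0.
have md0 : (0 : R) < (m ^ d)%:R by rewrite ltr0n expn_gt0 m0.
pose kap := lam * del / (4 * (m ^ d)%:R).
have kap0 : 0 < kap by rewrite divr_gt0 ?mulr_gt0.
have [n1 h1] := eventually_ge_nat ((m ^ d)%:R / kap).
exists kap, m, (maxn m n1); split=> // n A; rewrite geq_max => /andP[mn /h1 n1n] mean A2 E dE sep.
apply: le_trans (ball_chernoff mix m0 (ltW lam0) (ltW lam0) mC mean dE sep) _.
rewrite ler_wpM2l ?pr_ge0//; set N : R := (n.+1 ^ d)%:R.
have Nn : (m ^ d)%:R <= kap * N.
  rewrite -ler_pdivrMl// mulrC (le_trans n1n)// ler_nat.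
  exact: leq_trans (leqnSn _) (leq_expn_d _ d0).
have N0 : 0 < N by rewrite ltr0n expn_gt0.
have mexp : (m ^ d)%:R <= expR (kap * N).
  by apply: le_trans Nn _; apply: le_trans (expR_ge1Dx _); rewrite lerDr.
apply: (@le_trans _ _ (expR (kap * N) * expR (- (2 * kap * N)))); last first.
  by rewrite -expRD ler_expR; lra.
rewrite ler_pM ?expR_ge0// ?(ltW md0)// ler_expR.
have cls : ((n %/ m).+1 ^ d)%:R * (m ^ d)%:R <= 2 ^+ d * N.
  have := pattern_class_bound d m0 (leq_trans mn (leqnSn n)).
  by rewrite -(ler_nat R) !natrM [(2 ^ d)%:R]natrX.
have e : lam ^+ 2 + lam * lam = 2 * lam * lam by ring.
rewrite e.
have h : ((n %/ m).+1 ^ d)%:R <= 2 ^+ d * N / (m ^ d)%:R by rewrite ler_pdivlMr.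
have h2 : ((n %/ m).+1 ^ d)%:R * (2 * lam * lam) <= 2 ^+ d * N / (m ^ d)%:R * (2 * lam * lam).
  by rewrite ler_wpM2r// !mulr_ge0// ltW.
have e2 : 2 ^+ d * N / (m ^ d)%:R * (2 * lam * lam) = 2 * kap * N.
  have -> : 2 ^+ d * N / (m ^ d)%:R * (2 * lam * lam) =
    (2 ^+ d * lam) * (2 * lam * N / (m ^ d)%:R) by field; rewrite gt_eqF.
  by rewrite lt /kap; field; rewrite gt_eqF.
have e3 : lam * (del * N / (m ^ d)%:R) = 4 * kap * N.
  by rewrite /kap; field; rewrite gt_eqF.
by rewrite e3; lra.
Qed.

(** * Occurrences on grids *)

Section grids.
Context (d : nat).

Definition gpos K (i : {ffun 'I_d -> 'I_K}) : site d := [ffun k => (val (i k))%:Z].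

Definition grid K : seq (site d) := [seq gpos i | i <- enum {: {ffun 'I_d -> 'I_K}}].

Definition sscale (c : nat) (x : site d) : site d := [ffun k => c%:Z * x k].

Definition blocks (S : seq (site d)) F : seq (site d) :=
  [seq sadd y x | x <- S, y <- grid F].

Definition origins r c : seq (site d) := [seq sscale c x | x <- grid r].

Lemma gpos_inj K : injective (@gpos K).
Proof.
move=> i j /ffunP ij; apply/ffunP => k; apply: val_inj.
by have := ij k; rewrite !ffunE => -[].
Qed.

Lemma size_grid K : size (grid K) = (K ^ d)%N.
Proof. by rewrite size_map -cardE card_ffun !card_ord. Qed.

Lemma uniq_grid K : uniq (grid K).
Proof. by rewrite map_inj_uniq ?enum_uniq//; exact: gpos_inj. Qed.

Lemma mem_grid K (z : site d) :
  reflect (forall k, 0 <= z k < K%:Z) (z \in grid K).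
Proof.
apply: (iffP mapP) => [[i _ ->] k|h].
  by rewrite ffunE /= ltz_nat ltn_ord.
have hK k : (`|z k| < K)%N by have := h k; lia.
exists [ffun k => Ordinal (hK k)]; first by rewrite mem_enum.
apply/ffunP => k; rewrite !ffunE /=; have /andP[zk _] := h k.
by rewrite gez0_abs.
Qed.

Lemma mem_origins r c (z : site d) : z \in origins r c ->
  exists2 i : site d, i \in grid r & z = sscale c i.
Proof. by case/mapP => i ig ->; exists i. Qed.

Lemma size_blocks r c F : size (blocks (origins r c) F) = (r ^ d * F ^ d)%N.
Proof. by rewrite size_allpairs [size (origins _ _)]size_map !size_grid. Qed.

Lemma uniq_origins r c : (0 < c)%N -> uniq (origins r c).
Proof.
move=> c0; rewrite map_inj_uniq ?uniq_grid// => x y /ffunP xy.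
apply/ffunP => k; have := xy k; rewrite !ffunE.
by apply: mulfI; lia.
Qed.

Lemma origins_far r c (x x' : site d) : x \in origins r c -> x' \in origins r c ->
  x != x' -> exists k, (c <= `|x k - x' k|)%N.
Proof.
move=> /mem_origins[i _ ->] /mem_origins[j _ ->] ij.
have [k ijk] : exists k, i k != j k.
  apply/existsP; rewrite -negb_forall; apply: contra ij => /forallP ij.
  by apply/eqP/ffunP => k; rewrite !ffunE (eqP (ij k)).
exists k; rewrite !ffunE -mulrBr abszM absz_nat leq_pmulr//.
by rewrite lt0n absz_eq0 subr_eq0.
Qed.

Lemma mem_blocks S F z : z \in blocks S F -> exists x y,
  [/\ x \in S, y \in grid F & z = sadd y x].
Proof. by case/allpairsP => -[x y] /= [? ? ->]; exists x, y. Qed.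

Lemma uniq_blocks r c F : (0 < c)%N -> (F <= c)%N -> uniq (blocks (origins r c) F).
Proof.
move=> c0 Fc; apply: allpairs_uniq; [exact: uniq_origins|exact: uniq_grid|].
move=> /= xy xy' /allpairsP[[x y] /= [xS yF ->]] /allpairsP[[x' y'] /= [xS' yF' ->]] /= e.
have [xx'|/(origins_far xS xS')[k xk]] := eqVneq x x'.
  by move: e; rewrite xx' => /(can_inj (saddK _)) ->.
have := congr1 (fun z : site d => z k) e; rewrite !ffunE.
have := mem_grid _ _ yF k; have := mem_grid _ _ yF' k; lia.
Qed.

Lemma blocks_sub r c F K : (F <= c)%N -> (r * c <= K)%N ->
  {subset blocks (origins r c) F <= grid K}.
Proof.
move=> Fc rK z /mem_blocks[_ [y [/mem_origins[i /mem_grid ir ->] /mem_grid yF ->]]].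
apply/mem_grid => k; rewrite !ffunE.
have := yF k; have := ir k; case: (i k) => // a; nia.
Qed.

End grids.

Section occurrences.
Context (R : realType) (d n : nat) (A : patt d n) (eps : R).

Definition occ (x : site d) : set (Omega d) := tshift x @^-1` approx_ball A eps.

Definition hit (X : seq (site d)) : set (Omega d) := [set s | exists2 x, x \in X & occ x s].

Definition avoid (X : seq (site d)) : set (Omega d) := ~` hit X.

Lemma depends_tshift B (E : set (Omega d)) (x : site d) : depends_on B E ->
  depends_on (ftranslate x B) (tshift x @^-1` E).
Proof.
move=> BE s s' ss'; apply: BE => y yB; apply: ss'.
by rewrite mem_ftranslate saddK.
Qed.

Lemma depends_occ x : depends_on (ftranslate x (cubeS d n)) (occ x).
Proof. exact/depends_tshift/depends_ball. Qed.

Lemma measurable_occ x : measurable (occ x).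
Proof. exact: measurable_depends_on (depends_occ (x := x)). Qed.

Lemma depends_hit (B : {fset site d}) X :
  (forall x, x \in X -> {subset ftranslate x (cubeS d n) <= B}) ->
  depends_on B (hit X).
Proof.
move=> XB s s' ss'.
have h x : x \in X -> occ x s <-> occ x s'.
  by move=> xX; apply: (depends_onS (XB x xX) (depends_occ (x := x))).
by split=> -[x xX ox]; exists x => //; apply/(h x xX).
Qed.

Lemma measurable_hit X : measurable (hit X).
Proof.
apply: (measurable_depends_on
  (A := (\bigcup_(x <- X) ftranslate x (cubeS d n))%fset)).
apply: depends_hit => x xX y yx; apply/bigfcupP; exists x => //.
by rewrite andbT.
Qed.

Lemma measurable_avoid X : measurable (avoid X).
Proof. by apply: measurableC; exact: measurable_hit. Qed.

Lemma hit_cat X Y : hit (X ++ Y) = hit X `|` hit Y.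
Proof.
apply/seteqP; split=> s.
  by move=> [x]; rewrite mem_cat => /orP[xX|xY] ox; [left|right]; exists x.
by move=> [[x xX ox]|[x xY ox]]; exists x; rewrite // mem_cat ?xX ?xY ?orbT.
Qed.

Lemma avoid_cat X Y : avoid (X ++ Y) = avoid X `&` avoid Y.
Proof. by rewrite /avoid hit_cat setCU. Qed.

Lemma hit_sub X Y : {subset X <= Y} -> hit X `<=` hit Y.
Proof. by move=> XY s [x /XY xY ox]; exists x. Qed.

Lemma hit_nil : hit [::] = set0.
Proof. by apply/seteqP; split=> // s []. Qed.

Lemma avoid_nil : avoid [::] = setT.
Proof. by rewrite /avoid hit_nil setC0. Qed.

Lemma hit_cons x X : hit (x :: X) = occ x `|` hit X.
Proof.
apply/seteqP; split=> s.
  by move=> [y]; rewrite inE => /orP[/eqP ->|yX] oy; [left|right; exists y].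
by move=> [ox|[y yX oy]]; [exists x; rewrite ?mem_head|exists y; rewrite ?inE ?yX ?orbT].
Qed.

Lemma occ_tshift x y : tshift x @^-1` occ y = occ (sadd y x).
Proof. by apply/seteqP; split=> s; rewrite /occ /= tshiftD. Qed.

Lemma hit_tshift x X : tshift x @^-1` hit X = hit [seq sadd y x | y <- X].
Proof.
apply/seteqP; split=> s.
  move=> [y yX oy]; exists (sadd y x); first by apply/mapP; exists y.
  by rewrite -occ_tshift.
by move=> [_ /mapP[y yX ->]]; rewrite -occ_tshift => oy; exists y.
Qed.

Context (P : probability (Omega d) R).
Hypothesis stat : stationary_local P.

Definition pball : R := pr P (approx_ball A eps).

Lemma pr_occ x : pr P (occ x) = pball.
Proof. exact: stat (depends_ball A eps). Qed.

Lemma pr_hit_tshift x X : pr P (hit [seq sadd y x | y <- X]) = pr P (hit X).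
Proof.
rewrite -hit_tshift.
have dX : depends_on (\bigcup_(x <- X) ftranslate x (cubeS d n))%fset (hit X).
  apply: depends_hit => y yX z zy; apply/bigfcupP; exists y => //.
  by rewrite andbT.
exact: stat dX.
Qed.

Lemma pr_hit_le X : pr P (hit X) <= (size X)%:R * pball.
Proof.
apply: (@le_trans _ _ (\sum_(x <- X) pr P (occ x))).
  apply: pr_boole => //; [exact: measurable_hit|exact: measurable_occ].
under eq_bigr do rewrite pr_occ.
by rewrite big_const_seq count_predT iter_addr_0 mulr_natl.
Qed.

(** A second-order Bonferroni inequality, with the number of pairs bounded by the square of the
    size. *)
Lemma pr_hit_ge X (bb : R) :
  pairwise (fun x y => pr P (occ x `&` occ y) <= bb) X -> 0 <= bb ->
  (size X)%:R * pball - (size X)%:R ^+ 2 * bb <= pr P (hit X).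
Proof.
move=> + bb0; elim: X => [_|x X IH].
  by rewrite expr2 !mul0r subrr pr_ge0.
rewrite pairwise_cons => /andP[/allP xX /IH{}IH].
have mo : measurable (occ x) by exact: measurable_occ.
have mh : measurable (hit X) by exact: measurable_hit.
have mU := measurableU _ _ mo mh; have mI := measurableI _ _ mo mh.
have both : pr P (occ x `&` hit X) <= (size X)%:R * bb.
  apply: (@le_trans _ _ (\sum_(y <- X) pr P (occ x `&` occ y))).
    apply: pr_boole => //; first by move=> y; apply: measurableI => //; exact: measurable_occ.
    by move=> s [ox [y yX oy]]; exists y.
  rewrite big_seq (le_trans (ler_sum _ (fun y yX => xX y yX)))//.
  by rewrite -big_seq big_const_seq count_predT iter_addr_0 mulr_natl.
have e : pr P (hit (x :: X)) = pr P (occ x) + pr P (hit X) - pr P (occ x `&` hit X).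
  rewrite hit_cons (prID P mU mo) setUK (prID P mh mo) setIUl setICr set0U.
  by rewrite [hit X `&` occ x]setIC; lra.
rewrite e pr_occ /= -natr1.
have : 0 <= (size X)%:R * bb by rewrite mulr_ge0.
move: (_%:R) IH both => N IH both NB.
have -> : (N + 1) ^+ 2 * bb = N ^+ 2 * bb + 2 * (N * bb) + bb by ring.
lra.
Qed.

End occurrences.

(** * Products over separated blocks *)

Section hitting.
Context (R : realType) (d n : nat) (A : patt d n) (eps : R).

Lemma translate_in_cube k (x : site d) :
  (forall y : box d n, inC k (sadd (emb y) x)) <-> x \in grid d (k.+1 - n).
Proof.
split=> [h|/mem_grid h y i].
  apply/mem_grid => i.
  have := h [ffun=> ord0] i; have := h [ffun=> ord_max] i; rewrite !ffunE /=.
  by case: (x i) => // a; lia.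
have := h i; have := ltn_ord (y i); rewrite !ffunE.
by move: (x i) (y i : nat) => [a|a] b; lia.
Qed.

(** The largest C_k of volume at most [u] has k + 1 = v, and a copy of the pattern fits in it
    exactly at the positions of the grid of side v - n, which is empty for v <= n. When it is not
    empty, [0 < n] ensures the condition k > 0. *)
Lemma hitting_time_gt (u : R) (v : nat) : (0 < d)%N -> (0 < n)%N ->
  (v ^ d)%:R <= u -> u < (v.+1 ^ d)%:R ->
  [set s : Omega d | (u%:E < hitting_time A eps s)%E] = avoid A eps (grid d (v - n)).
Proof.
move=> d0 n0 vu uv; apply/seteqP; split=> s /=.
  rewrite ltNge => /negP h [x xg ox]; apply: h.
  have vn : (n < v)%N.
    by have := mem_grid _ _ xg (Ordinal d0); lia.
  apply: (@le_trans _ _ ((v ^ d)%:R)%:E); last by rewrite lee_fin.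
  apply: ereal_inf_lbound; exists v.-1; last by rewrite card_box prednK//; lia.
  split; first by lia.
  exists x; split=> //; apply/translate_in_cube.
  by rewrite prednK//; lia.
move=> av; apply: (@lt_le_trans _ _ ((v.+1 ^ d)%:R)%:E); first by rewrite lte_fin.
apply: le_ereal_inf_tmp => _ [k [k0 [x [xk ox]]] <-].
rewrite lee_fin card_box ler_nat leq_exp2r//.
rewrite leqNgt; apply/negP => kv; apply: av; exists x => //.
apply/mem_grid => i; move/translate_in_cube : xk => /mem_grid /(_ i).
by case: (x i) => // a; lia.
Qed.

End hitting.

Section block_product.
Context (R : realType) (d n : nat) (A : patt d n) (eps : R) (P : probability (Omega d) R).
Context (C1 C2 : R).
Hypotheses (stat : stationary_local P) (mix : exp_mixing P C1 C2).
Context (f g m : nat).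
Hypotheses (f0 : (0 < f)%N) (m0 : (0 < m)%N) (mg : (m + n <= g)%N).

Definition qhit : R := pr P (hit A eps (grid d f)).
(** Cost of decoupling one block: deciding whether positions in a cube of side [f] are hit involves
    f + n sites per direction, and this volume is the factor |A1| of nonuniform mixing. *)
Definition mix_err : R := ((f + n) ^ d)%:R * (C1 * expR (- C2 * m%:R)).

(** The new block plays the part of [A1], so the error involves the volume of one block only and
    stays proportional to the probability of avoiding all the others. *)
Lemma blocks_step (x : site d) (S : seq (site d)) :
  (forall x', x' \in S -> exists k, (f + g <= `|x k - x' k|)%N) ->
  `|pr P (avoid A eps (blocks (x :: S) f)) - (1 - qhit) * pr P (avoid A eps (blocks S f))|
    <= mix_err * pr P (avoid A eps (blocks S f)).
Proof.
move=> far.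
have mh X : measurable (hit A eps X) by exact: measurable_hit.
have -> : blocks (x :: S) f = [seq sadd y x | y <- grid d f] ++ blocks S f by [].
rewrite avoid_cat /qhit -(pr_hit_tshift A eps stat x) -prC//.
pose A1 := ftranslate x (cubeS d (f.-1 + n)).
pose A2 := (\bigcup_(z <- blocks S f) ftranslate z (cubeS d n))%fset.
have d1 : depends_on A1 (avoid A eps [seq sadd y x | y <- grid d f]).
  apply: depends_onC; apply: depends_hit => _ /mapP[y /mem_grid yf ->] z.
  rewrite !mem_ftranslate => /mem_cubeS h; apply/mem_cubeS => k.
  by have := h k; have := yf k; rewrite !ffunE; lia.
have d2 : depends_on A2 (avoid A eps (blocks S f)).
  apply: depends_onC; apply: depends_hit => z zb y yz.
  by apply/bigfcupP; exists z => //; rewrite andbT.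
have sep a b : a \in A1 -> b \in A2 -> (m <= sdist a b)%N.
  rewrite mem_ftranslate => /mem_cubeS ha /bigfcupP[z]; rewrite andbT.
  move=> /mem_blocks[x' [y [xS /mem_grid yf ->]]]; rewrite mem_ftranslate => /mem_cubeS hb.
  have [k xk] := far _ xS; apply: leq_trans (sdist_ge_coord _ _ k).
  move: (ha k) (hb k) (yf k) xk; rewrite !ffunE; clear -mg f0.
  by move: (a k) (b k) (x k) (x' k) (y k) => ak bk xk xk' yk; lia.
have := mix m0 sep d1 d2.
by rewrite /A1 card_ftranslate card_cubeS (_ : (f.-1 + n).+1 = f + n)%N//; lia.
Qed.

Lemma qhit01 : 0 <= qhit <= 1.
Proof. by rewrite pr_ge0 pr_le1//; exact: measurable_hit. Qed.

(** Because each step has a relative error, the induction yields two bounds: a geometric one, for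
    the tail in large [t], and an additive one, linear in the number of blocks, for precision in
    [n]. *)
Lemma blocks_product (S : seq (site d)) :
  pairwise (fun x x' : site d => [exists k, (f + g <= `|x k - x' k|)%N]) S ->
  0 <= mix_err ->
  pr P (avoid A eps (blocks S f)) <= (1 - qhit + mix_err) ^+ size S /\
  `|pr P (avoid A eps (blocks S f)) - (1 - qhit) ^+ size S| <= (size S)%:R * mix_err.
Proof.
move=> + e0; have /andP[q0 q1] := qhit01.
elim: S => [_|x S IH].
  by rewrite /= avoid_nil prT expr0 mul0r subrr normr0.
rewrite pairwise_cons => /andP[/allP xS /IH{IH}[IH1 IH2]].
have far x' : x' \in S -> exists k, (f + g <= `|x k - x' k|)%N.
  by move=> /xS /existsP[k]; exists k.
have mA : measurable (avoid A eps (blocks S f)) by exact: measurable_avoid.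
have a0 := pr_ge0 P (avoid A eps (blocks S f)).
have a1 := pr_le1 P mA.
have := blocks_step far; move: a0 a1 IH1 IH2 => /=.
move: (pr P (avoid A eps (blocks S f))) (pr P (avoid A eps (blocks (x :: S) f))).
move: qhit mix_err q0 q1 e0 => q e q0 q1 e0 a b a0 a1 IH1 IH2 h.
have q10 : 0 <= 1 - q by lra.
split.
  rewrite exprS; apply: (@le_trans _ _ ((1 - q + e) * a)).
    by move: h; rewrite ler_norml => /andP[_]; lra.
  by rewrite ler_wpM2l//; lra.
have -> : b - (1 - q) ^+ (size S).+1 = (b - (1 - q) * a) + (1 - q) * (a - (1 - q) ^+ size S).
  by rewrite exprS; ring.
have -> : (size S).+1%:R * e = e + (size S)%:R * e by rewrite -natr1; ring.
apply: le_trans (ler_normD _ _) _; apply: lerD.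
  by rewrite (le_trans h)// -[leRHS]mulr1 ler_wpM2l.
rewrite normrM ger0_norm// -[leRHS]mul1r ler_pM//; lra.
Qed.

Lemma pairwise_origins r :
  pairwise (fun x x' : site d => [exists k, (f + g <= `|x k - x' k|)%N]) (origins d r (f + g)).
Proof.
have c0 : (0 < f + g)%N by lia.
apply: pairwise_neq; first exact: uniq_origins.
by move=> x x' xo xo' /(origins_far xo xo')[k h]; apply/existsP; exists k.
Qed.

Lemma avoid_grid_le r K : (r * (f + g) <= K)%N ->
  pr P (avoid A eps (grid d K)) <= pr P (avoid A eps (blocks (origins d r (f + g)) f)).
Proof.
move=> rK; have mav X : measurable (avoid A eps X) by exact: measurable_avoid.
apply: pr_le => //; apply: subsetC; apply: hit_sub.
by apply: blocks_sub rK; exact: leq_addr.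
Qed.

(** Positions of the cube outside the blocks are handled by a union bound, each costing [pball]. *)
Lemma avoid_blocks_le r K : (r * (f + g) <= K)%N ->
  pr P (avoid A eps (blocks (origins d r (f + g)) f)) <= pr P (avoid A eps (grid d K)) +
  ((K ^ d)%:R - (r ^ d * f ^ d)%:R) * pball A eps P.
Proof.
move=> rK; set B := blocks _ _.
have mav X : measurable (avoid A eps X) by exact: measurable_avoid.
have mh X : measurable (hit A eps X) by exact: measurable_hit.
pose D := [seq x <- grid d K | x \notin B].
have szD : (size D + size B <= K ^ d)%N.
  rewrite -size_grid -(count_predC (mem B) (grid d K)) addnC leq_add//; last first.
    by rewrite /D size_filter.
  rewrite -size_filter; apply: uniq_leq_size.
    by apply: uniq_blocks; [lia|exact: leq_addr].
  move=> z zB; rewrite mem_filter /= zB /=.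
  by apply: blocks_sub zB; [exact: leq_addr|].
apply: (@le_trans _ _ (pr P (avoid A eps (grid d K) `|` hit A eps D))).
  apply: pr_le => //; first exact: measurableU.
  move=> s sB; have [|sD] := pselect (hit A eps D s); first by right.
  left=> -[x xK ox]; have [xB|xB] := boolP (x \in B); first by apply: sB; exists x.
  by apply: sD; exists x => //; rewrite mem_filter xB.
rewrite (le_trans (prU_le _ _ _))// lerD2l (le_trans (pr_hit_le A eps stat D))//.
rewrite ler_wpM2r ?pr_ge0// lerBrDr -natrD ler_nat.
by rewrite /B size_blocks in szD.
Qed.

End block_product.

(** * Sparse families of positions *)

Section lower.
Context (R : realType) (d n : nat) (A : patt d n) (eps alpha eta : R) (P : probability (Omega d) R).
Context (m a : nat).
Hypotheses (stat : stationary_local P) (gA : good eps alpha A) (eta0 : 0 <= eta).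
Hypothesis decor : forall A2 E, depends_on A2 E ->
  (forall x y, x \in cubeS d n -> y \in A2 -> (m <= sdist x y)%N) ->
  pr P (E `&` approx_ball A eps) <= pr P E * eta.
Hypotheses (a0 : (0 < a)%N) (aal : a.-1%:R <= alpha * n%:R).

(** Two positions in one small block differ by at most [alpha * n], so goodness makes the
    occurrences disjoint. In different blocks the copies are at least [m] apart, and the
    decorrelation hypothesis gives joint probability at most [eta] times that of one occurrence. *)
Lemma hit_sparse_ge r X : X = blocks (origins d r (a + n + m)) a ->
  (size X)%:R * pball A eps P - (size X)%:R ^+ 2 * (pball A eps P * eta) <= pr P (hit A eps X).
Proof.
move=> ->; apply: pr_hit_ge => //; last by rewrite mulr_ge0// pr_ge0.
apply: pairwise_neq; first by apply: uniq_blocks; lia.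
move=> x y /mem_blocks[v [u [oO /mem_grid ua xE]]] /mem_blocks[v' [u' [oO' /mem_grid ua' yE]]] xy.
pose del := sadd y (sopp x).
have yx : sadd del x = y by rewrite /del saddNK.
have dE k : del k = u' k + v' k - (u k + v k) by rewrite /del xE yE !ffunE.
clearbody del.
have [oo|/(origins_far oO oO')[k ok]] := eqVneq v v'.
  rewrite (_ : _ `&` _ = set0) ?pr0 ?mulr_ge0 ?pr_ge0//.
  apply/seteqP; split=> // s [ox oy].
  have : (approx_ball A eps `&` (tshift del @^-1` approx_ball A eps)) (tshift x s).
    by split=> //=; rewrite tshiftD yx.
  rewrite gA//.
    rewrite lt0n; apply: contra xy => /eqP s0; apply/eqP/ffunP => k.
    have := sdist_ge_coord del (sorigin d) k; rewrite s0 dE xE yE !ffunE oo.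
    by clear; move: (u k) (u' k) (v' k) => uk uk' vk; lia.
  apply: le_trans aal; rewrite ler_nat; apply/sdist_leP => k.
  have := ua k; have := ua' k; rewrite dE ffunE oo; clear -a0.
  by move: (u k) (u' k) (v' k) => uk uk' vk; lia.
have -> : occ A eps x `&` occ A eps y = tshift x @^-1` (occ A eps del `&` approx_ball A eps).
  by rewrite preimage_setI occ_tshift yx setIC.
have dep : depends_on (ftranslate del (cubeS d n) `|` cubeS d n)%fset
    (occ A eps del `&` approx_ball A eps).
  apply: depends_onI.
    by apply: depends_onS (@depends_occ R d n A eps del) => z zd; rewrite inE zd.
  by apply: depends_onS (depends_ball A eps) => z zd; rewrite inE zd orbT.
rewrite (stat _ dep) -(pr_occ A eps stat del).
apply: decor (@depends_occ R d n A eps del) _ => z w /mem_cubeS hz.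
rewrite mem_ftranslate => /mem_cubeS hw.
apply: leq_trans (sdist_ge_coord _ _ k).
move: (hz k) (hw k) (ua k) (ua' k) ok; rewrite !ffunE dE; clear -a0.
by move: (z k) (w k) (u k) (u' k) (v k) (v' k) => zk wk uk uk' vk vk'; lia.
Qed.

End lower.

(** * Exponential approximation *)

Lemma exists_root_floor (R : realType) (d : nat) (u : R) : (0 < d)%N -> 0 <= u ->
  exists v : nat, (v ^ d)%:R <= u /\ u < (v.+1 ^ d)%:R.
Proof.
move=> d0 u0; have [w1 w2] : (Num.truncn u)%:R <= u /\ u < (Num.truncn u).+1%:R.
  by have /andP[] := truncn_itv u0.
set w := Num.truncn u in w1 w2.
have ex : exists v, (v ^ d <= w)%N by exists 0%N; rewrite exp0n.
have bnd v : (v ^ d <= w)%N -> (v <= w)%N.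
  by case: v => // v; apply: leq_trans; exact: leq_expn_d.
case: (ex_maxnP ex bnd) => v vw vmax; exists v; split.
  by apply: le_trans w1; rewrite ler_nat.
apply: lt_le_trans w2 _; rewrite ler_nat ltnNge; apply/negP => /vmax.
by rewrite ltnn.
Qed.

Lemma expB_le_nat (d x y : nat) : (y <= x)%N ->
  (x ^ d.+1 <= y ^ d.+1 + d.+1 * (x - y) * x ^ d)%N.
Proof.
move=> yx; elim: d => [|d IH]; first by rewrite !expn1 expn0 muln1 mul1n subnKC.
rewrite [(x ^ d.+2)%N]expnS [(y ^ d.+2)%N]expnS.
have h1 : (x * x ^ d.+1 = y * x ^ d.+1 + (x - y) * x ^ d.+1)%N.
  by rewrite -mulnDl subnKC.
have h2 : (y * x ^ d.+1 <= y * y ^ d.+1 + d.+1 * (x - y) * x ^ d.+1)%N.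
  apply: leq_trans (leq_mul (leqnn y) IH) _; rewrite mulnDr leq_add2l.
  by rewrite mulnCA [(x ^ d.+1)%N]expnS leq_mul2l leq_mul2r yx !orbT.
rewrite h1; move: h2; set X := (x ^ d.+1)%N; set Y := (y ^ d.+1)%N.
by rewrite [(d.+2 * _)%N]mulSn [((_ + _) * X)%N]mulnDl; lia.
Qed.

Lemma expR_lip (R : realType) (a b : R) : 0 <= a -> a <= b ->
  `|expR (- a) - expR (- b)| <= b - a.
Proof.
move=> a0 ab; rewrite ger0_norm; last by rewrite subr_ge0 ler_expR lerN2.
have -> : expR (- b) = expR (- a) * expR (- (b - a)) by rewrite -expRD; congr expR; ring.
have ea : expR (- a) <= 1 by rewrite expR_le1 oppr_le0.
have eb := expR_ge1Dx (- (b - a)).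
have -> : expR (- a) - expR (- a) * expR (- (b - a)) = expR (- a) * (1 - expR (- (b - a))).
  by ring.
apply: (@le_trans _ _ (expR (- a) * (b - a))).
  by rewrite ler_wpM2l ?expR_ge0//; lra.
by rewrite -[leRHS]mul1r ler_wpM2r//; lra.
Qed.

(* The [r] blocks per side have side [f] and period [f + g]: what they miss of the cube
   of side [v + 1] is made of the corridors and of a boundary layer. *)
Lemma uncovered_le (R : realType) (d f g n v r : nat) (u : R) :
  (0 < d)%N -> (0 < f)%N -> (0 < g)%N -> (g + n <= f)%N -> (v ^ d)%:R <= u ->
  r = ((v - n) %/ (f + g))%N ->
  (v.+1 ^ d)%:R - ((r * f) ^ d)%:R <=
  d%:R * 2 ^+ d.+2 * (g%:R / f%:R * u + (f ^ (2 * d))%:R).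
Proof.
move=> d0 f0 g0 gnf vu rE.
have rf : (r * (f + g) <= v - n)%N by rewrite rE; exact: leq_divM.
have rv : (v.+1 <= r.+1 * (f + g) + n)%N.
  have : (v - n < r.+1 * (f + g))%N by rewrite rE ltn_ceil//; lia.
  lia.
have rfv : (r * f <= v)%N by nia.
have width : (v.+1 - r * f <= r * g + 2 * f)%N by nia.
have f0R : 0 < f%:R :> R by rewrite ltr0n.
have u0 : 0 <= u by apply: le_trans vu; rewrite ler0n.
have gf0 : 0 <= g%:R / f%:R :> R by rewrite divr_ge0.
have step : ((v.+1 ^ d)%:R - ((r * f) ^ d)%:R : R) <=
    d%:R * ((r * g)%:R + 2 * f%:R) * (v.+1 ^ d.-1)%:R.
  rewrite lerBlDl; case: (d) d0 => // d' _.
  have := @expB_le_nat d' v.+1 (r * f) (leqW rfv).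
  rewrite -(ler_nat R) natrD !natrM => h; apply: le_trans h _.
  rewrite lerD2l ler_wpM2r// ler_wpM2l//.
  by rewrite -[2%:R]/(2%:R) -!natrM -natrD ler_nat.
apply: le_trans step _; rewrite -[X in X <= _]mulrA -[X in _ <= X]mulrA ler_wpM2l//.
have v1 : (0 < v)%N -> (v.+1 ^ d)%:R <= 2 ^+ d * u.
  move=> v0; apply: (@le_trans _ _ (2 ^+ d * (v ^ d)%:R)); last first.
    by rewrite ler_wpM2l// exprn_ge0.
  by rewrite -natrX -natrM ler_nat -expnMn leq_exp2r//; lia.
have dS : (v.+1 ^ d = v.+1 * v.+1 ^ d.-1)%N by rewrite -expnS prednK.
have t1 : (r * g)%:R * (v.+1 ^ d.-1)%:R <= 2 ^+ d * (g%:R / f%:R * u).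
  have [v0|v0] := posnP v.
    have -> : r = 0%N by rewrite rE v0 sub0n div0n.
    by rewrite mul0n mul0r mulr_ge0// ?exprn_ge0// mulr_ge0.
  apply: (@le_trans _ _ (g%:R / f%:R * (v.+1 ^ d)%:R)).
    rewrite dS [(v.+1 * _)%:R]natrM mulrA ler_wpM2r// mulrAC ler_pdivlMr// -!natrM ler_nat.
    have : (r * f * g <= v.+1 * g)%N by rewrite leq_mul2r leqW// orbT.
    lia.
  by rewrite [leRHS]mulrCA ler_wpM2l// v1.
have t2 : f%:R * (v.+1 ^ d.-1)%:R <= (f ^ (2 * d))%:R + 2 ^+ d * (g%:R / f%:R * u).
  (* A cube of side at most f^2 is charged to the additive term. Beyond that the boundary layer is
     at most a fraction 1/f of the volume, and 1 <= g absorbs it in the corridor term. *)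
  have [vf|vf] := leqP v.+1 (f ^ 2).
    apply: (@le_trans _ _ (f ^ (2 * d))%:R); last first.
      by rewrite lerDl mulr_ge0// ?exprn_ge0// mulr_ge0.
    rewrite -natrM ler_nat; apply: (@leq_trans (f * (f ^ 2) ^ d.-1)).
      rewrite leq_mul2l; apply/orP; right; case: (d.-1) => // k.
      by rewrite leq_exp2r.
    rewrite -expnM -expnS leq_pexp2l//; lia.
  have v0 : (0 < v)%N by rewrite -ltnS (leq_ltn_trans _ vf)// expn_gt0 f0.
  apply: (@le_trans _ _ (2 ^+ d * (g%:R / f%:R * u))); last by rewrite lerDr.
  apply: (@le_trans _ _ ((v.+1 ^ d)%:R / f%:R)).
    by rewrite ler_pdivlMr// -!natrM ler_nat dS mulnAC leq_mul2r mulnn ltnW// orbT.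
  have -> : 2 ^+ d * (g%:R / f%:R * u) = g%:R * (2 ^+ d * u) / f%:R by ring.
  rewrite ler_pM2r ?invr_gt0// (le_trans (v1 v0))// ler_peMl ?ler1n//.
  by rewrite mulr_ge0// exprn_ge0.
have -> : ((r * g)%:R + 2 * f%:R) * (v.+1 ^ d.-1)%:R =
  (r * g)%:R * (v.+1 ^ d.-1)%:R + 2 * (f%:R * (v.+1 ^ d.-1)%:R) :> R by ring.
have -> : 2 ^+ d.+2 * (g%:R / f%:R * u + (f ^ (2 * d))%:R) =
  4 * (2 ^+ d * (g%:R / f%:R * u)) + 4 * (2 ^+ d * (f ^ (2 * d))%:R) :> R.
  by rewrite !exprS; ring.
have t3 : (f ^ (2 * d))%:R <= 2 ^+ d * (f ^ (2 * d))%:R :> R.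
  by rewrite -[leLHS]mul1r ler_wpM2r// exprn_ege1// ler1n.
have t4 : 0 <= 2 ^+ d * (g%:R / f%:R * u) by rewrite mulr_ge0 ?exprn_ge0// mulr_ge0.
have t5 : (0 : R) <= (f ^ (2 * d))%:R by [].
move: t1 t2 t3 t4 t5.
by move: (_ * (g%:R / f%:R * u)) (2 ^+ d * (f ^ _)%:R) => X Y; lra.
Qed.

Lemma side_le_blocks (d f g n v r : nat) : (0 < d)%N -> (0 < f)%N ->
  r = ((v - n) %/ (f + g))%N -> (v.+1 ^ d <= (r ^ d).+1 * (2 * (f + g + n)) ^ d)%N.
Proof.
move=> d0 f0 rE.
have K : (v - n < r.+1 * (f + g))%N by rewrite rE ltn_ceil//; lia.
have rG : (v.+1 <= r.+1 * (f + g + n))%N by clear -K; nia.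
move: rG; move: (f + g + n)%N => G rG; clear -d0 rG.
have [r0|r0] := posnP r.
  rewrite r0 exp0n// mul1n leq_exp2r//; rewrite r0 mul1n in rG; lia.
apply: (@leq_trans (r ^ d * (2 * G) ^ d)); last by rewrite leq_mul2r leqnSn orbT.
by rewrite -expnMn leq_exp2r//; apply: leq_trans rG _; clear -r0; nia.
Qed.

(** * Avoidance probabilities of large cubes *)

Section estimates.
Context (R : realType) (d n : nat) (A : patt d n) (eps : R) (P : probability (Omega d) R).
Context (C1 C2 : R).
Hypotheses (d0 : (0 < d)%N) (n0 : (0 < n)%N).
Hypotheses (stat : stationary_local P) (C10 : 0 < C1) (mix : exp_mixing P C1 C2).
Context (f g m : nat).
Hypotheses (f0 : (0 < f)%N) (m0 : (0 < m)%N) (mg : (m + n <= g)%N).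

Let q := qhit A eps P f.
Let e : R := mix_err d n C1 C2 f m.
Let p := pball A eps P.

Let e_ge0 : 0 <= e.
Proof. by rewrite /e /mix_err !mulr_ge0// ?expR_ge0// ltW. Qed.

Lemma tail_bound (u : R) (v : nat) : 0 <= u -> u < (v.+1 ^ d)%:R -> e <= q / 2 ->
  pr P (avoid A eps (grid d (v - n))) <=
  expR 1 * expR (- (q / (2 * ((2 * (f + g + n)) ^ d)%:R) * u)).
Proof.
move=> u0 uv eq; have /andP[q0 q1] := qhit01 A eps P f; rewrite -/q in q0 q1.
set r := ((v - n) %/ (f + g))%N.
have rK : (r * (f + g) <= v - n)%N by exact: leq_divM.
apply: le_trans (avoid_grid_le A eps P rK) _.
have [le _] := blocks_product A eps stat mix f0 m0 mg (pairwise_origins d f0 m0 mg r) e_ge0.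
apply: le_trans le _; rewrite -/q -/e.
have -> : size (origins d r (f + g)) = (r ^ d)%N by rewrite size_map size_grid.
have b1 : 1 - q + e <= expR (- (q / 2)).
  by apply: le_trans (expR_ge1Dx _); lra.
have b0 : 0 <= 1 - q + e by have := e_ge0; lra.
apply: (@le_trans _ _ (expR (- (q / 2)) ^+ (r ^ d))).
  by rewrite lerXn2r ?nnegrE ?expR_ge0.
rewrite -expRM_natl -expRD ler_expR.
set G := (f + g + n)%N; have G0 : (0 : R) < ((2 * G) ^ d)%:R.
  by rewrite ltr0n expn_gt0 muln_gt0 /G -addnA addn_gt0 f0.
have Rge : u / ((2 * G) ^ d)%:R <= (r ^ d)%:R + 1.
  rewrite ler_pdivrMr// (le_trans (ltW uv))// natr1 -natrM ler_nat.
  exact: side_le_blocks.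
have -> : q / (2 * ((2 * G) ^ d)%:R) * u = q / 2 * (u / ((2 * G) ^ d)%:R).
  by field; rewrite gt_eqF.
have : q / 2 * (u / ((2 * G) ^ d)%:R) <= q / 2 * ((r ^ d)%:R + 1).
  by rewrite ler_wpM2l//; lra.
rewrite mulrDr mulr1 mulrN [_ * (q / 2)]mulrC; lra.
Qed.

(** By the equation for [Lam], the power of 1 - q is exactly the exponential of - Lam p (r f)^d,
    while t = Lam p u. The uncovered volume thus enters twice, by a union bound with weight p and
    through the exponent with weight Lam p; the last term is the mixing error over at most u / f^d
    blocks. *)
Lemma approx_bound (t Lam u : R) (v : nat) : 0 < q < 1 -> 0 < p -> 0 < Lam ->
  Lam * (p * (f ^ d)%:R) = - ln (1 - q) -> (g + n <= f)%N ->
  u = t / (Lam * p) -> 0 <= u -> (v ^ d)%:R <= u -> u < (v.+1 ^ d)%:R ->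
  `|pr P (avoid A eps (grid d (v - n))) - expR (- t)| <=
  (1 + Lam) * p * (d%:R * 2 ^+ d.+2 * (g%:R / f%:R * u + (f ^ (2 * d))%:R)) +
  u / (f ^ d)%:R * e.
Proof.
move=> /andP[q0 q1] p0 Lam0 LamE gnf uE u0 vu uv.
set r := ((v - n) %/ (f + g))%N.
have rK : (r * (f + g) <= v - n)%N by exact: leq_divM.
have g0 : (0 < g)%N by rewrite (leq_trans _ mg)// addn_gt0 m0.
have unc := uncovered_le d0 f0 g0 gnf vu (erefl r).
have ub := avoid_grid_le A eps P rK.
have lb := avoid_blocks_le A eps stat f0 m0 mg rK.
have [_ pe] := blocks_product A eps stat mix f0 m0 mg (pairwise_origins d f0 m0 mg r) e_ge0.
have sz : size (origins d r (f + g)) = (r ^ d)%N by rewrite size_map size_grid.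
rewrite sz -/q -/e in pe; rewrite -/p in lb.
move: ub lb pe; set X := pr P (avoid A eps (grid d _)); set B := pr P _ => ub lb pe.
have tE : t = Lam * p * u by rewrite uE mulrC divfK// gt_eqF// mulr_gt0.
have fd0 : (0 : R) < (f ^ d)%:R by rewrite ltr0n expn_gt0 f0.
have powE : (1 - q) ^+ (r ^ d) = expR (- (Lam * p * ((r * f) ^ d)%:R)).
  rewrite -[1 - q]lnK; last by rewrite posrE; lra.
  rewrite -expRM_natl; congr expR.
  have -> : ln (1 - q) = - (Lam * (p * (f ^ d)%:R)) by rewrite LamE opprK.
  by rewrite expnMn natrM; ring.
have rfv : (r * f <= v)%N.
  by rewrite (leq_trans _ (leq_subr n v))// (leq_trans _ rK)// leq_mul2l leq_addr orbT.
have rfu : ((r * f) ^ d)%:R <= u by rewrite (le_trans _ vu)// ler_nat leq_exp2r.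
have lip : `|(1 - q) ^+ (r ^ d) - expR (- t)| <= t - Lam * p * ((r * f) ^ d)%:R.
  rewrite powE; apply: expR_lip; first by rewrite !mulr_ge0// ltW.
  by rewrite tE ler_pM2l// mulr_gt0.
set D := d%:R * _ * _ in unc *.
have Kv : ((v - n) ^ d)%:R <= (v.+1 ^ d)%:R :> R by rewrite ler_nat leq_exp2r// leqW// leq_subr.
have e1 : ((v - n) ^ d)%:R - (r ^ d * f ^ d)%:R <= D.
  by rewrite -expnMn (le_trans _ unc)// lerD2r.
have e2 : u - ((r * f) ^ d)%:R <= D by rewrite (le_trans _ unc)// lerD2r ltW.
have e3 : (((v - n) ^ d)%:R - (r ^ d * f ^ d)%:R) * p <= D * p by rewrite ler_wpM2r// ltW.
have e4 : t - Lam * p * ((r * f) ^ d)%:R <= Lam * p * D.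
  by rewrite tE -mulrBr ler_wpM2l// mulr_ge0// ltW.
have e5 : (r ^ d)%:R * e <= u / (f ^ d)%:R * e.
  by rewrite ler_wpM2r// ler_pdivlMr// -natrM -expnMn.
move: pe lip; rewrite !ler_norml => /andP[? ?] /andP[? ?].
have -> : (1 + Lam) * p * D = D * p + Lam * p * D by ring.
by apply/andP; split; lra.
Qed.

End estimates.

Lemma pball_ge (R : realType) d n (A : patt d n) (eps C0 : R) (P : probability (Omega d) R) :
  0 <= eps ->
  (forall L eta, expR (- (#|` L|%:R * C0)) <= pr P (agree_on L eta)) ->
  expR (- (C0 * (n.+1 ^ d)%:R)) <= pball A eps P.
Proof.
move=> eps0 en; pose eta : Omega d := fun z => A (unemb n z).
apply: (@le_trans _ _ (pr P (agree_on (cubeS d n) eta))).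
  by apply: le_trans (en _ _); rewrite card_cubeS mulrC.
apply: pr_le => [||s sA].
- exact: measurable_depends_on (@depends_agree_on d (cubeS d n) eta).
- exact: measurable_depends_on (depends_ball A eps).
rewrite /approx_ball /= (_ : hamming s A = 0%N) ?mulr_ge0//.
apply: big1 => y _; rewrite sA; last by apply/mem_cubeS; exact: emb_inC.
by rewrite /eta embK eqxx.
Qed.

(* Both bounds are multiplied: [D ^ 2] is at most their product. *)
Lemma interpolate_bound (R : realType) (D C5 C6 c kap t x : R) :
  0 <= D -> 0 < C5 -> 0 < C6 -> 0 < c -> 0 < t ->
  D <= C5 * (1 + t) * expR (- kap * x) -> D <= C6 * expR (- c * t) ->
  D <= (C5 * C6 * (1 + 2 / c) + 1) * expR (- (c / 4) * t) * expR (- (kap / 2) * x).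
Proof.
move=> D0 C50 C60 c0 t0 h1 h2.
set S := C5 * C6 * (1 + 2 / c).
have S0 : 0 <= S by rewrite /S !mulr_ge0// ?addr_ge0 ?divr_ge0// ltW.
rewrite -(@ler_pXn2r _ 2)// ?nnegrE ?mulr_ge0 ?expR_ge0 ?addr_ge0//.
have tb : 1 + t <= (1 + 2 / c) * expR (c * t / 2).
  have : 1 + c * t / 2 <= expR (c * t / 2) by exact: expR_ge1Dx.
  set E := expR _ => hE.
  have E1 : 1 <= E.
    by apply: le_trans hE; rewrite lerDl divr_ge0// mulr_ge0// ltW.
  have tE : t = 2 / c * (c * t / 2) by field; rewrite gt_eqF.
  have : t <= 2 / c * E.
    rewrite [leLHS]tE ler_wpM2l//; first by rewrite divr_ge0// ltW.
    by apply: le_trans hE; rewrite lerDr.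
  have -> : (1 + 2 / c) * E = E + 2 / c * E by ring.
  lra.
apply: (@le_trans _ _ (S * (expR (- c * t / 2) * expR (- kap * x)))).
  have -> : expR (- c * t / 2) = expR (c * t / 2) * expR (- c * t).
    by rewrite -expRD; congr expR; field.
  rewrite expr2; apply: le_trans (ler_pM D0 D0 h1 h2) _.
  have -> : C5 * (1 + t) * expR (- kap * x) * (C6 * expR (- c * t)) =
    (C5 * C6 * (expR (- c * t) * expR (- kap * x))) * (1 + t) by ring.
  have -> : S * (expR (c * t / 2) * expR (- c * t) * expR (- kap * x)) =
    (C5 * C6 * (expR (- c * t) * expR (- kap * x))) * ((1 + 2 / c) * expR (c * t / 2)).
    by rewrite /S; ring.
  by rewrite ler_wpM2l// !mulr_ge0// ?expR_ge0// ltW.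
rewrite !exprMn -!expRM_natl.
have -> : 2%:R * (- (c / 4) * t) = - c * t / 2 by field.
have -> : 2%:R * (- (kap / 2) * x) = - kap * x by field.
rewrite -[leRHS]mulrA ler_wpM2r ?mulr_ge0 ?expR_ge0//.
rewrite expr2; nra.
Qed.

Lemma exists_scale (R : realType) (x : R) : 1 <= x ->
  exists f : nat, [/\ (0 < f)%N, x <= f%:R & f%:R <= 2 * x].
Proof.
move=> x1; exists (Num.truncn x).+1; split=> //.
  exact: ltW (truncnS_gt x).
have /andP[h _] : (Num.truncn x)%:R <= x < (Num.truncn x).+1%:R.
  by apply: truncn_itv; lra.
by rewrite -natr1; lra.
Qed.

Lemma exists_sparse_density (R : realType) (alpha : R) (n m f : nat) :
  0 < alpha < 1 -> (0 < n)%N -> (2 * n + 1 + m <= f)%N ->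
  exists a r : nat, [/\ (0 < a)%N, a.-1%:R <= alpha * n%:R,
    (r * (a + n + m) <= f)%N, (r * a <= f)%N &
    alpha / (2 * (3 + m%:R)) * f%:R <= (r * a)%:R].
Proof.
move=> /andP[al0 al1] n0 nf.
have an0 : 0 <= alpha * n%:R by rewrite mulr_ge0// ltW.
have /andP[ta tb] := truncn_itv an0.
set b := Num.truncn _ in ta tb.
have bn : (b <= n)%N.
  rewrite -(ler_nat R) (le_trans ta)// -[leRHS]mul1r ler_wpM2r//; lra.
pose pi := (b.+1 + n + m)%N.
have pi0 : (0 < pi)%N by rewrite /pi addSn.
have pif : (pi <= f)%N by rewrite /pi; clear -bn nf; lia.
(* [a = b.+1] is the largest side with a - 1 <= alpha n. The period a + n + m is at most (3 + m) n,
   so blocks fill a fraction at least alpha / (3 + m) of it per direction; the factor 2 pays for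
   rounding f / pi down. *)
exists b.+1, (f %/ pi)%N; split=> //; first exact: leq_divM.
  by apply: leq_trans (leq_divM f pi); rewrite leq_mul2l /pi -addnA leq_addr orbT.
have r1 : (1 <= f %/ pi)%N by rewrite divn_gt0.
have fr : (f <= 2 * (f %/ pi) * pi)%N.
  have gen (F r p : nat) : (1 <= r)%N -> (F < r.+1 * p)%N -> (F <= 2 * r * p)%N.
    by clear; nia.
  by apply: gen => //; rewrite ltn_ceil.
have m0 : 0 < 2 * (3 + m%:R) :> R by rewrite mulr_gt0// ltr_pwDl.
rewrite mulrAC ler_pdivrMr// natrM.
have piR : alpha * pi%:R <= b.+1%:R * (3 + m%:R).
  apply: (@le_trans _ _ (alpha * n%:R * (3 + m%:R))); last first.
    by rewrite ler_wpM2r ?ltW// ltr_pwDl.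
  rewrite -mulrA ler_pM2l// -natrD -natrM ler_nat /pi.
  by clear -bn n0; nia.
apply: (@le_trans _ _ (alpha * (2 * (f %/ pi) * pi)%:R)).
  by rewrite ler_pM2l// ler_nat.
rewrite !natrM.
have -> : alpha * (2 * (f %/ pi)%:R * pi%:R) = 2 * (f %/ pi)%:R * (alpha * pi%:R) by ring.
have -> : (f %/ pi)%:R * b.+1%:R * (2 * (3 + m%:R)) =
  2 * (f %/ pi)%:R * (b.+1%:R * (3 + m%:R)) :> R by ring.
by rewrite ler_wpM2l.
Qed.

Lemma ln1B_bounds (R : realType) (q : R) : 0 < q <= 1 / 2 ->
  q <= - ln (1 - q) <= 2 * q.
Proof.
move=> /andP[q0 q1]; have q10 : 0 < 1 - q by lra.
have h1 : expR (ln (1 - q)) = 1 - q by rewrite lnK.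
have h2 : expR (- ln (1 - q)) * (1 - q) = 1 by rewrite -[X in _ * X]h1 -expRD addNr expR0.
have gen (E l : R) : E * (1 - q) = 1 -> 1 + - l <= E -> 1 + l <= 1 - q ->
    q <= - l <= 2 * q.
  move=> e h3 h4; have : (1 - l) * (1 - q) <= E * (1 - q) by rewrite ler_pM2r.
  by rewrite e => h5; apply/andP; split; nra.
by apply: gen h2 (expR_ge1Dx _) _; rewrite -[leRHS]h1; exact: expR_ge1Dx.
Qed.

Lemma linear_le_expR (R : realType) (B k x : R) : 0 < k -> 0 <= x -> 4 * B / k ^+ 2 <= x ->
  B * x <= expR (k * x).
Proof.
move=> k0 x0; rewrite ler_pdivrMr ?exprn_gt0// => h.
have e : expR (k * x) = expR (k * x / 2) ^+ 2 by rewrite -expRM_natl; congr expR; field.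
have h1 : 1 + k * x / 2 <= expR (k * x / 2) := expR_ge1Dx _.
have kx : 0 <= k * x by rewrite mulr_ge0// ltW.
have h2 : (k * x / 2) ^+ 2 <= expR (k * x / 2) ^+ 2.
  by rewrite lerXn2r ?nnegrE ?expR_ge0// ?divr_ge0//; lra.
rewrite e; apply: le_trans h2.
have -> : (k * x / 2) ^+ 2 = (x * k ^+ 2) * x / 4 by field.
have : 4 * B * x <= x * k ^+ 2 * x by rewrite ler_wpM2r.
lra.
Qed.

(** * The error for one pattern at given scales *)

Definition hit_error (R : realType) d (P : probability (Omega d) R) n (A : patt d n)
    (eps Lam t : R) : R :=
  `| fine (P [set s : Omega d | ((t / (Lam * fine (P (approx_ball A eps))))%:E
                                  < hitting_time A eps s)%E]) - expR (- t) |.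

Section one_pattern.
Context (R : realType) (d n : nat) (A : patt d n) (eps : R) (P : probability (Omega d) R).
Context (C1 C2 : R).
Hypotheses (d0 : (0 < d)%N) (n0 : (0 < n)%N).
Hypotheses (stat : stationary_local P) (C10 : 0 < C1) (mix : exp_mixing P C1 C2).
Context (f g m : nat).
Hypotheses (f0 : (0 < f)%N) (m0 : (0 < m)%N) (mg : (m + n <= g)%N).

Let q := qhit A eps P f.
Let p := pball A eps P.

Lemma hit_errorE (Lam t : R) (v : nat) : let u := t / (Lam * p) in
  (v ^ d)%:R <= u -> u < (v.+1 ^ d)%:R ->
  hit_error P A eps Lam t = `|pr P (avoid A eps (grid d (v - n))) - expR (- t)|.
Proof. by move=> u vu uv; rewrite /hit_error (hitting_time_gt A eps d0 n0 vu uv). Qed.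

Lemma hit_error_tail (Lam t c : R) : 0 < Lam -> 0 < p -> 0 < t -> 0 <= c -> c <= 1 ->
  mix_err d n C1 C2 f m <= q / 2 ->
  c * (Lam * p) <= q / (2 * ((2 * (f + g + n)) ^ d)%:R) ->
  hit_error P A eps Lam t <= (expR 1 + 1) * expR (- c * t).
Proof.
move=> Lam0 p0 t0 c0 c1 eq cq.
have Lp : 0 < Lam * p by rewrite mulr_gt0.
have u0 : 0 <= t / (Lam * p) by rewrite divr_ge0// ltW.
have [v [vu uv]] := exists_root_floor d0 u0.
rewrite (hit_errorE vu uv).
have := tail_bound d0 stat C10 mix f0 m0 mg u0 uv eq.
set X := pr P _; set G := q / _ => tb.
have X0 : 0 <= X by exact: pr_ge0.
have le1 : expR (- (G * (t / (Lam * p)))) <= expR (- c * t).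
  rewrite ler_expR mulNr lerN2 -[leLHS]/(c * t).
  have -> : c * t = c * (Lam * p) * (t / (Lam * p)) by field; rewrite !gt_eqF.
  by rewrite ler_wpM2r.
have le2 : expR (- t) <= expR (- c * t).
  by rewrite ler_expR mulNr lerN2 -[leRHS]mul1r ler_wpM2r// ltW.
have le3 : X <= expR 1 * expR (- c * t).
  by apply: le_trans tb _; rewrite ler_wpM2l// expR_ge0.
have e0 : 0 <= expR (- t) := expR_ge0 _.
have e1 : 0 <= expR (- c * t) := expR_ge0 _.
have e2 : 0 <= expR 1 * expR (- c * t) by rewrite mulr_ge0// expR_ge0.
rewrite mulrDl mul1r ler_norml; apply/andP; split; lra.
Qed.

(** The scales stay abstract: [eta] bounds the ball, [c3] is the density of effective positions, and
    [th] dominates the three sources of error, namely corridors (g / f), boundary layer (p f^(2d))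
    and mixing ([eta]). *)
Lemma one_pattern (c3 Cg eta th : R) : 0 < p -> p <= eta -> 0 < c3 <= 1 ->
  (g + n <= f)%N -> c3 * ((f ^ d)%:R * p) <= q ->
  (f ^ d)%:R * eta <= 1 / 2 -> expR (- C2 * m%:R) <= p * eta ->
  2 ^+ d.+1 * C1 * eta <= c3 -> 0 <= Cg -> g%:R / f%:R <= Cg * th ->
  p * (f ^ (2 * d))%:R <= 4 ^+ d * th -> eta <= th ->
  exists Lam : R, c3 <= Lam <= 2 /\ forall t, 0 < t ->
    hit_error P A eps Lam t <=
      (3 * (d%:R * 2 ^+ d.+2) * (Cg / c3 + 4 ^+ d) + 2 ^+ d * C1 / c3) * (1 + t) * th /\
    hit_error P A eps Lam t <= (expR 1 + 1) * expR (- (c3 / 4 ^+ d.+1) * t).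
Proof.
move=> p0 peta /andP[c30 c31] gnf qlow feta mdec C1eta Cg0 gf pf etath.
have fd0 : (0 : R) < (f ^ d)%:R by rewrite ltr0n expn_gt0 f0.
have eta0 : 0 < eta by apply: lt_le_trans peta.
have th0 : 0 < th by apply: lt_le_trans etath.
have fp0 : 0 < (f ^ d)%:R * p by rewrite mulr_gt0.
have fp : (f ^ d)%:R * p <= 1 / 2.
  by apply: le_trans feta; rewrite ler_pM2l.
have qup : q <= (f ^ d)%:R * p.
  by apply: le_trans (pr_hit_le A eps stat _) _; rewrite size_grid.
have q0 : 0 < q by apply: lt_le_trans qlow; rewrite mulr_gt0.
have q1 : 0 < q <= 1 / 2 by rewrite q0 (le_trans qup).
have /andP[ln1 ln2] := ln1B_bounds q1.
(* Here c3 f^d p <= q <= f^d p, and q <= - ln (1 - q) <= 2 q because q <= 1/2; together they place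
   [Lam] between [c3] and 2. *)
pose Lam := - ln (1 - q) / ((f ^ d)%:R * p).
have Lam3 : c3 <= Lam by rewrite /Lam ler_pdivlMr// (le_trans qlow).
have Lam2 : Lam <= 2.
  by rewrite /Lam ler_pdivrMr// (le_trans ln2)// ler_pM2l.
have Lam0 : 0 < Lam by apply: lt_le_trans Lam3.
have fn : ((f + n) ^ d)%:R <= 2 ^+ d * (f ^ d)%:R :> R.
  have : ((f + n) ^ d <= 2 ^ d * f ^ d)%N.
    rewrite -expnMn leq_exp2r// mul2n -addnn leq_add2l.
    by rewrite (leq_trans _ gnf)// leq_addl.
  by rewrite -(ler_nat R) natrM [(2 ^ d)%:R]natrX.
have errle : mix_err d n C1 C2 f m <= 2 ^+ d * (f ^ d)%:R * (C1 * (p * eta)).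
  rewrite /mix_err ler_pM// ?mulr_ge0 ?expR_ge0// ?(ltW C10)//.
  by rewrite ler_pM2l.
have errq : mix_err d n C1 C2 f m <= q / 2.
  apply: le_trans errle _; rewrite ler_pdivlMr// (le_trans _ qlow)//.
  have -> : 2 ^+ d * (f ^ d)%:R * (C1 * (p * eta)) * 2 =
    2 ^+ d.+1 * C1 * eta * ((f ^ d)%:R * p) by rewrite exprS; ring.
  by rewrite ler_pM2r.
exists Lam; split; first by rewrite Lam3.
move=> t t0; split; last first.
  apply: hit_error_tail => //.
  - by rewrite divr_ge0 ?exprn_ge0// ltW.
  - rewrite ler_pdivrMr ?exprn_gt0// mul1r (le_trans c31)// exprn_ege1//.
    by rewrite ler1n.
  have Gf : ((2 * (f + g + n)) ^ d)%:R <= 4 ^+ d * (f ^ d)%:R :> R.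
    have : ((2 * (f + g + n)) ^ d <= 4 ^ d * f ^ d)%N.
      rewrite -expnMn leq_exp2r// -addnA.
      by apply: (@leq_trans (2 * (f + f))); [rewrite leq_mul2l leq_add2l gnf orbT|clear; lia].
    by rewrite -(ler_nat R) natrM [(4 ^ d)%:R]natrX.
  have G0 : (0 : R) < ((2 * (f + g + n)) ^ d)%:R.
    by rewrite ltr0n expn_gt0 muln_gt0 -addnA addn_gt0 f0.
  have f4 : (0 : R) < 4 ^+ d by rewrite exprn_gt0.
  rewrite ler_pdivlMr ?mulr_gt0//.
  apply: (@le_trans _ _ (c3 / 4 ^+ d.+1 * (2 * p) * (2 * (4 ^+ d * (f ^ d)%:R)))).
    have c4 : 0 <= c3 / 4 ^+ d.+1 by rewrite divr_ge0 ?exprn_ge0// ltW.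
    apply: ler_pM.
    - by rewrite mulr_ge0// ltW// mulr_gt0.
    - by rewrite mulr_ge0// ltW.
    - by rewrite ler_wpM2l// ler_pM2r.
    - by rewrite ler_pM2l.
  have -> : c3 / 4 ^+ d.+1 * (2 * p) * (2 * (4 ^+ d * (f ^ d)%:R)) = c3 * ((f ^ d)%:R * p).
    by rewrite exprS; field; rewrite gt_eqF.
  exact: qlow.
have Lp : 0 < Lam * p by rewrite mulr_gt0.
have u0 : 0 <= t / (Lam * p) by rewrite divr_ge0// ltW.
have [v [vu uv]] := exists_root_floor d0 u0.
rewrite (hit_errorE vu uv).
have qlt : 0 < q < 1 by rewrite q0 (le_lt_trans qup)// (le_lt_trans fp)//; lra.
have LamE : Lam * (p * (f ^ d)%:R) = - ln (1 - q).
  by rewrite [p * _]mulrC /Lam divfK// gt_eqF.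
apply: le_trans (approx_bound d0 stat C10 mix f0 m0 mg qlt p0 Lam0 LamE gnf (erefl _) u0 vu uv) _.
set u := t / _ in u0 vu uv *.
have pu : p * u <= t / c3.
  have -> : p * u = t / Lam by rewrite /u; field; rewrite !gt_eqF.
  by rewrite ler_pM2l// lef_pV2.
have tc0 : 0 <= t / c3 by rewrite divr_ge0// ltW.
have D0 : 0 <= d%:R * 2 ^+ d.+2 :> R by rewrite mulr_ge0// exprn_ge0.
have first : (1 + Lam) * p * (d%:R * 2 ^+ d.+2 * (g%:R / f%:R * u + (f ^ (2 * d))%:R)) <=
    3 * (d%:R * 2 ^+ d.+2) * (Cg * th * (t / c3) + 4 ^+ d * th).
  have -> : (1 + Lam) * p * (d%:R * 2 ^+ d.+2 * (g%:R / f%:R * u + (f ^ (2 * d))%:R)) =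
    (1 + Lam) * (d%:R * 2 ^+ d.+2) * (g%:R / f%:R * (p * u) + p * (f ^ (2 * d))%:R) by ring.
  have g0 : 0 <= g%:R / f%:R * (p * u) :> R.
    by rewrite mulr_ge0 ?divr_ge0// mulr_ge0// ltW.
  rewrite ler_pM//.
  - by rewrite mulr_ge0//; lra.
  - by rewrite addr_ge0// mulr_ge0// ltW.
  - by rewrite ler_wpM2r//; lra.
  - rewrite lerD// ler_pM ?divr_ge0//.
    by rewrite mulr_ge0// ltW.
have second : u / (f ^ d)%:R * mix_err d n C1 C2 f m <= 2 ^+ d * C1 * eta * (t / c3).
  apply: (@le_trans _ _ (u / (f ^ d)%:R * (2 ^+ d * (f ^ d)%:R * (C1 * (p * eta))))).
    by rewrite ler_wpM2l// divr_ge0// ltW.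
  have -> : u / (f ^ d)%:R * (2 ^+ d * (f ^ d)%:R * (C1 * (p * eta))) =
    2 ^+ d * C1 * eta * (p * u) by field; rewrite gt_eqF.
  by rewrite ler_wpM2l// !mulr_ge0 ?exprn_ge0// ltW.
have third : 2 ^+ d * C1 * eta * (t / c3) <= 2 ^+ d * C1 * th * (t / c3).
  by rewrite ler_wpM2r// ler_wpM2l// mulr_ge0 ?exprn_ge0// ltW.
apply: le_trans (lerD first (le_trans second third)) _.
rewrite -subr_ge0.
have -> : (3 * (d%:R * 2 ^+ d.+2) * (Cg / c3 + 4 ^+ d) + 2 ^+ d * C1 / c3) * (1 + t) * th -
  (3 * (d%:R * 2 ^+ d.+2) * (Cg * th * (t / c3) + 4 ^+ d * th) + 2 ^+ d * C1 * th * (t / c3)) =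
  (3 * (d%:R * 2 ^+ d.+2) * (Cg / c3 + 4 ^+ d * t) + 2 ^+ d * C1 / c3) * th by ring.
rewrite mulr_ge0 ?(ltW th0)// addr_ge0//.
  apply: mulr_ge0; first by rewrite mulr_ge0.
  by rewrite addr_ge0 ?divr_ge0 ?(ltW c30)// mulr_ge0 ?exprn_ge0// ltW.
by rewrite divr_ge0 ?(ltW c30)// mulr_ge0 ?exprn_ge0// ltW.
Qed.

End one_pattern.

(** * Choice of the scales for large patterns *)

Lemma qhit_ge_sparse (R : realType) d n (A : patt d n) (eps alpha eta : R)
    (P : probability (Omega d) R) (m f : nat) :
  (0 < d)%N -> (0 < n)%N -> stationary_local P -> good eps alpha A -> 0 <= eta ->
  (forall A2 E, depends_on A2 E ->
    (forall x y, x \in cubeS d n -> y \in A2 -> (m <= sdist x y)%N) ->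
    pr P (E `&` approx_ball A eps) <= pr P E * eta) ->
  0 < alpha < 1 -> (2 * n + 1 + m <= f)%N -> (f ^ d)%:R * eta <= 1 / 2 ->
  (alpha / (2 * (3 + m%:R))) ^+ d / 2 * ((f ^ d)%:R * pball A eps P) <= qhit A eps P f.
Proof.
move=> d0 n0 stat gA eta0 decor al nf feta.
have [a [r [a0 aal raf rf dens]]] := exists_sparse_density al n0 nf.
have h := hit_sparse_ge stat gA eta0 decor a0 aal (erefl (blocks (origins d r (a + n + m)) a)).
have aF : (a <= a + n + m)%N by rewrite -addnA leq_addr.
have hq : pr P (hit A eps (blocks (origins d r (a + n + m)) a)) <= qhit A eps P f.
  apply: pr_le; [exact: measurable_hit|exact: measurable_hit|].
  by apply: hit_sub; exact: blocks_sub.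
apply: le_trans (le_trans h hq); rewrite size_blocks -expnMn.
set S : R := ((r * a) ^ d)%:R; set p := pball _ _ _.
have p0 : 0 <= p by exact: pr_ge0.
have S0 : 0 <= S by [].
have Sf : S <= (f ^ d)%:R by rewrite ler_nat leq_exp2r.
have Seta : S * eta <= 1 / 2 by apply: le_trans feta; rewrite ler_wpM2r.
have b0 : 0 <= alpha / (2 * (3 + m%:R)).
  by case/andP: al => al0 _; rewrite divr_ge0 ?(ltW al0)// mulr_ge0// addr_ge0.
have Sb : (alpha / (2 * (3 + m%:R))) ^+ d * (f ^ d)%:R <= S.
  by rewrite /S !natrX -exprMn lerXn2r ?nnegrE// mulr_ge0.
have e1 : S * p - S ^+ 2 * (p * eta) = S * p * (1 - S * eta) by ring.
(* The Bonferroni correction takes at most half of the first-order term as long as f^d eta <= 1/2: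
   this is what limits the growth of [f]. *)
rewrite e1; apply: (@le_trans _ _ (S * p * (1 / 2))).
  have -> : (alpha / (2 * (3 + m%:R))) ^+ d / 2 * ((f ^ d)%:R * p) =
    (alpha / (2 * (3 + m%:R))) ^+ d * (f ^ d)%:R * p * (1 / 2) by ring.
  by rewrite ler_wpM2r// ler_wpM2r.
by rewrite ler_wpM2l ?mulr_ge0//; lra.
Qed.

Lemma large_patterns (R : realType) d (P : probability (Omega d) R) (C0 C1 C2 eps alpha : R) :
  (0 < d)%N -> stationary_local P -> 0 < C1 -> 0 < C2 -> exp_mixing P C1 C2 -> 0 < C0 ->
  (forall L eta, expR (- (#|` L|%:R * C0)) <= pr P (agree_on L eta)) ->
  0 < eps < 1 -> 0 < alpha < 1 ->
  exists n0 : nat, exists L1 C c K : R, [/\ 0 < L1 <= 1, 0 < C, 0 < c & 0 < K] /\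
    forall n (A : patt d n), (n0 <= n)%N -> (0 < n)%N -> good eps alpha A ->
      exists Lam : R, L1 <= Lam <= 2 /\ forall t, 0 < t ->
        hit_error P A eps Lam t <= C * expR (- c * t) * expR (- K * (n.+1 ^ d)%:R).
Proof.
move=> d0 stat C10 C20 mix C00 en eps01 al01.
have /andP[eps0 _] := eps01; have /andP[al0 al1] := al01.
have [del del0 [n1 mean]] := good_mean d0 stat eps01 al0.
have [kap [m1 [n2 [kap0 m10 small]]]] := ball_exp_small eps d0 mix C20 del0.
have dR : (1 : R) <= d%:R by rewrite ler1n.
have dR0 : (0 : R) < d%:R by rewrite ltr0n.
(* With f of order exp(k1 N), f^d is of order exp(kap N / 4), so both f^d eta and p f^(2d) keep an
   exponentially small factor. *)
pose k1 : R := kap / (4 * d%:R).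
have k10 : 0 < k1 by rewrite divr_gt0// mulr_gt0.
have k1d : d%:R * k1 = kap / 4 by rewrite /k1; field; rewrite gt_eqF.
have k1kap : k1 <= kap by rewrite ler_pdivrMr ?mulr_gt0// ler_peMr ?(ltW kap0)//; lra.
have [M0 hM] := eventually_ge_nat ((C0 + kap) / C2).
(* Corridors of width MM N give exp(- C2 m) <= exp(- (C0 + kap) N) <= p eta, whatever the size of p
   above exp(- C0 N). *)
pose MM := M0.+1.
have MM2 : C0 + kap <= C2 * MM%:R by rewrite -ler_pdivrMl// mulrC hM// leqnSn.
pose b : R := alpha / (2 * (3 + m1%:R)).
have m13 : 0 < 2 * (3 + m1%:R) :> R by rewrite mulr_gt0// ltr_pwDl.
have b0 : 0 < b by rewrite divr_gt0.
have b1 : b <= 1.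
  rewrite /b ler_pdivrMr// mul1r; have : (0 : R) <= m1%:R by []. 
  by move=> ?; lra.
pose c3 : R := b ^+ d / 2.
have c30 : 0 < c3 by rewrite divr_gt0 ?exprn_gt0.
have c31 : c3 <= 1.
  have : b ^+ d <= 1 by rewrite exprn_ile1// ltW.
  by rewrite /c3 ler_pdivrMr// => h; lra.
(* B N <= exp(k1 N) makes room inside [f] both for the corridors, m + 2n, and for a period of the
   sparse family. *)
pose B : R := (MM%:R + 2) + (3 + m1%:R).
(* Its two summands serve the bounds [feta] and [C1eta], once n is large enough for Bc w <= 1. *)
pose Bc : R := 2 ^+ d.+1 + 2 ^+ d.+1 * C1 / c3.
have [n3 h3] := eventually_ge_nat (4 * B / k1 ^+ 2).
have [n4 h4] := eventually_ge_nat (Bc / (kap / 2)).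
(* The corridor width is at most (MM + 1) N, and N <= (2 / k1) exp(k1 N / 2); division by f >=
   exp(k1 N) leaves [th]. *)
pose Cg : R := (MM%:R + 1) * (2 / k1).
have Cg0 : 0 <= Cg.
  by apply: mulr_ge0; [exact: addr_ge0 | rewrite divr_ge0// ltW].
pose C5 : R := 3 * (d%:R * 2 ^+ d.+2) * (Cg / c3 + 4 ^+ d) + 2 ^+ d * C1 / c3.
pose C6 : R := expR 1 + 1.
pose c4 : R := c3 / 4 ^+ d.+1.
have p2 k : (0 : R) < 2 ^+ k by rewrite exprn_gt0.
have p4 k : (0 : R) < 4 ^+ k by rewrite exprn_gt0.
have c40 : 0 < c4 by rewrite divr_gt0.
have C60 : 0 < C6 by rewrite addr_gt0// expR_gt0.
have C50 : 0 < C5.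
  apply: ltr_pwDr; first by rewrite divr_gt0// mulr_gt0.
  apply: mulr_ge0; first by rewrite mulr_ge0// mulr_ge0// ltW.
  by rewrite addr_ge0 ?(ltW (p4 _))// divr_ge0// ltW.
exists (maxn (maxn n1 n2) (maxn n3 n4)), c3, (C5 * C6 * (1 + 2 / c4) + 1), (c4 / 4), (k1 / 2 / 2).
split.
  split; first by rewrite c30.
  - have h1 : 0 <= 1 + 2 / c4 by rewrite addr_ge0// divr_ge0// ltW.
    have h2 : 0 <= C5 * C6 by apply: mulr_ge0; exact: ltW.
    by apply: ltr_wpDl => //; exact: mulr_ge0.
  - exact: divr_gt0.
  - by apply: divr_gt0 => //; exact: divr_gt0.
move=> n A; rewrite !geq_max => /andP[/andP[n1n n2n] /andP[/h3 n3n /h4 n4n]] n0 gA.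
have meanA := mean n A n1n gA.
have decor := small n A n2n meanA.
set N : R := (n.+1 ^ d)%:R in decor *.
have nN : n.+1%:R <= N by rewrite ler_nat leq_expn_d.
have nN' : n%:R + 1 <= N by rewrite natr1.
have n0R : (0 : R) <= n%:R by [].
have N1 : 1 <= N by lra.
have N0 : 0 < N by lra.
set eta := expR (- kap * N) in decor.
set p := pball A eps P.
have plow : expR (- (C0 * N)) <= p by exact: pball_ge (ltW eps0) en.
have p0 : 0 < p by apply: lt_le_trans plow; exact: expR_gt0.
have peta : p <= eta.
  have := decor fset0 setT (@depends_onT d fset0).
  by rewrite setTI prT mul1r; apply => x y _; rewrite inE.
(* [w] is the square root of [eta] and [W] its inverse: one factor [w] cancels the growth of powers
   of [f], the other remains as smallness. *)
set w := expR (- (kap / 2) * N).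
set W := expR (kap / 2 * N).
have wW : w * W = 1 by rewrite -expRD mulNr addNr expR0.
have w0 : 0 < w by exact: expR_gt0.
have etaE : eta = w * w by rewrite -expRD; congr expR; field.
have w1 : w <= 1 by rewrite /w mulNr expR_le1 oppr_le0 mulr_ge0 ?divr_ge0// ltW.
have etaw : eta <= w by rewrite etaE -[leRHS]mulr1 ler_pM2l.
have eta0 : 0 <= eta by exact: expR_ge0.
have BcW : Bc <= W.
  apply: le_trans (expR_ge1Dx _); rewrite (@le_trans _ _ (kap / 2 * N))//; last by rewrite lerDr.
  by rewrite -ler_pdivrMl ?divr_gt0// mulrC (le_trans n4n)//; lra.
have Bcw : Bc * w <= 1 by rewrite -wW mulrC ler_pM2l.
pose th := expR (- (k1 / 2) * N).
have wth : w <= th.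
  by rewrite ler_expR !mulNr lerN2 ler_wpM2r ?(ltW N0)// ler_pM2r.
have BN : B * N <= expR (k1 * N).
  by apply: linear_le_expR; rewrite ?(ltW N0)// (le_trans n3n)//; lra.
have x1 : 1 <= expR (k1 * N) by rewrite -expR0 ler_expR mulr_ge0// ltW.
have [f [f0 xf fx]] := exists_scale x1.
(* Two separations coexist: the constant [m1] of the concentration bound, inside a cube, and this
   [m] of order N, between cubes. *)
have [m mE] : exists m, m = (MM * n.+1 ^ d)%N by exists (MM * n.+1 ^ d)%N.
have m0 : (0 < m)%N by rewrite mE muln_gt0 expn_gt0.
have mR : m%:R = MM%:R * N :> R by rewrite mE natrM.
have m1R : (0 : R) <= m1%:R by [].
have MMR : (0 : R) <= MM%:R by [].
have m1N : m1%:R <= m1%:R * N by rewrite ler_peMr.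
have MN0 : 0 <= MM%:R * N by rewrite mulr_ge0// ltW.
have BE : B * N = MM%:R * N + 5 * N + m1%:R * N by rewrite /B; ring.
have gnf : (m + n + n <= f)%N.
  by rewrite -(ler_nat R) !natrD mR; move: BN; rewrite BE; lra.
have nmf : (2 * n + 1 + m1 <= f)%N.
  by rewrite -(ler_nat R) natrD natrD natrM; move: BN; rewrite BE; lra.
have fd : (f ^ d)%:R <= 2 ^+ d * expR (kap / 4 * N).
  rewrite -k1d natrX (_ : expR _ = expR (k1 * N) ^+ d); last first.
    by rewrite -expRM_natl mulrA.
  by rewrite -exprMn lerXn2r ?nnegrE// mulr_ge0// expR_ge0.
have W4 : expR (kap / 4 * N) <= W.
  by rewrite ler_expR ler_wpM2r ?(ltW N0)//; lra.
have feta : (f ^ d)%:R * eta <= 1 / 2.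
  apply: (@le_trans _ _ (2 ^+ d * W * (w * w))).
    by rewrite etaE ler_pM// ?mulr_ge0 ?(ltW w0)// (le_trans fd)// ler_pM2l.
  have -> : 2 ^+ d * W * (w * w) = 2 ^+ d.+1 * w * (w * W) / 2 by rewrite exprS; field.
  rewrite wW mulr1 ler_pM2r ?invr_gt0// (le_trans _ Bcw)// ler_pM2r// lerDl.
  by rewrite divr_ge0 ?(ltW c30)// mulr_ge0// ltW.
have f2d : (f ^ (2 * d))%:R <= 4 ^+ d * W :> R.
  have -> : (f ^ (2 * d))%:R = (f ^ d)%:R * (f ^ d)%:R :> R by rewrite -natrM -expnD addnn mul2n.
  have -> : 4 ^+ d * W = (2 ^+ d * expR (kap / 4 * N)) * (2 ^+ d * expR (kap / 4 * N)).
    have -> : W = expR (kap / 4 * N) * expR (kap / 4 * N) by rewrite -expRD; congr expR; field.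
    have -> : 4 ^+ d = 2 ^+ d * 2 ^+ d :> R by rewrite -exprMn; congr (_ ^+ _); ring.
    by ring.
  by rewrite ler_pM.
have pf2 : p * (f ^ (2 * d))%:R <= 4 ^+ d * th.
  apply: (@le_trans _ _ (w * w * (4 ^+ d * W))).
    by rewrite ler_pM// ?(ltW p0)// -etaE.
  have -> : w * w * (4 ^+ d * W) = 4 ^+ d * w * (w * W) by ring.
  by rewrite wW mulr1 ler_pM2l.
have gf : (m + n)%:R / f%:R <= Cg * th.
  have f0R : (0 : R) < f%:R by rewrite ltr0n.
  rewrite ler_pdivrMr//.
  apply: (@le_trans _ _ (Cg * th * expR (k1 * N))); last first.
    by rewrite ler_wpM2l// mulr_ge0// expR_ge0.
  have -> : Cg * th * expR (k1 * N) = Cg * expR (k1 / 2 * N).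
    by rewrite -mulrA -expRD; congr (_ * expR _); field.
  apply: (@le_trans _ _ ((MM%:R + 1) * N)).
    by rewrite natrD mR mulrDl mul1r lerD2l; lra.
  rewrite /Cg -[leRHS]mulrA ler_wpM2l ?addr_ge0//.
  have eN : N = 2 / k1 * (k1 / 2 * N) by field; rewrite gt_eqF.
  have k20 : 0 <= 2 / k1 by rewrite divr_ge0// ltW.
  have hE : k1 / 2 * N <= expR (k1 / 2 * N).
    by apply: le_trans (expR_ge1Dx _); rewrite lerDr.
  by rewrite [leLHS]eN; exact: ler_wpM2l hE.
have mdec : expR (- C2 * m%:R) <= p * eta.
  apply: (@le_trans _ _ (expR (- (C0 * N)) * eta)); last by rewrite ler_wpM2r.
  rewrite -expRD ler_expR mR.
  have : (C0 + kap) * N <= C2 * MM%:R * N by rewrite ler_pM2r.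
  lra.
have C1eta : 2 ^+ d.+1 * C1 * eta <= c3.
  apply: (@le_trans _ _ (2 ^+ d.+1 * C1 * w)).
    by rewrite ler_wpM2l// mulr_ge0// ltW.
  have -> : 2 ^+ d.+1 * C1 * w = c3 * (2 ^+ d.+1 * C1 / c3 * w) by field; rewrite gt_eqF.
  rewrite -[leRHS]mulr1 ler_pM2l// (le_trans _ Bcw)// ler_pM2r// lerDr.
  exact: ltW.
have qlow := qhit_ge_sparse d0 n0 stat gA eta0 decor al01 nmf feta.
have c3b : 0 < c3 <= 1 by rewrite c30.
have [Lam [Lam01 bnd]] := one_pattern d0 n0 stat C10 mix f0 m0 (leqnn (m + n))
  p0 peta c3b gnf qlow feta mdec C1eta Cg0 gf pf2 (le_trans etaw wth).
exists Lam; split=> // t t0; have [h1 h2] := bnd t t0.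
exact: interpolate_bound (normr_ge0 _) C50 C60 c40 t0 h1 h2.
Qed.

(** * Finitely many small patterns, and the assembly *)

Lemma finite_lower_bound (R : realType) (T : finType) (c : T -> R) :
  (forall i, 0 < c i) -> exists2 c0, 0 < c0 & forall i, c0 <= c i.
Proof.
(* The inverse of one plus the sum of inverses lies below every [c i] and remains a valid witness
   for an empty [T]. *)
move=> cpos; pose S := 1 + \sum_i (c i)^-1.
have s0 : 0 <= \sum_i (c i)^-1 by apply: sumr_ge0 => i _; rewrite invr_ge0 ltW.
have S0 : 0 < S by rewrite ltr_pwDl.
exists S^-1 => [|i]; first by rewrite invr_gt0.
rewrite -[leRHS]invrK lef_pV2 ?posrE ?invr_gt0// /S (bigD1 i)//= addrCA lerDl.
by rewrite addr_ge0// sumr_ge0// => j _; rewrite invr_ge0 ltW.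
Qed.

(** For bounded [n] only decay in [t] matters, so [Lam] = 1 and blocks with a single position (f =
    1) suffice, separated by a corridor [m] that may depend on the pattern. *)
Lemma small_pattern (R : realType) d n (A : patt d n) (P : probability (Omega d) R)
    (C0 C1 C2 eps : R) :
  (0 < d)%N -> (0 < n)%N -> stationary_local P -> 0 < C1 -> 0 < C2 -> exp_mixing P C1 C2 ->
  (forall L eta, expR (- (#|` L|%:R * C0)) <= pr P (agree_on L eta)) -> 0 <= eps ->
  exists2 c : R, 0 < c & forall t, 0 < t ->
    hit_error P A eps 1 t <= (expR 1 + 1) * expR (- c * t).
Proof.
move=> d0 n0 stat C10 C20 mix en eps0.
have p0 : 0 < pball A eps P by apply: lt_le_trans (pball_ge A eps0 en); exact: expR_gt0.
have p1 : pball A eps P <= 1.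
  by apply: pr_le1; exact: measurable_depends_on (depends_ball A eps).
set p := pball A eps P in p0 p1.
have qp : p <= qhit A eps P 1.
  rewrite /p -(pr_occ A eps stat (sorigin d)); apply: pr_le.
  - exact: measurable_occ.
  - exact: measurable_hit.
  - move=> s os; exists (sorigin d) => //.
    by apply/mem_grid => k; rewrite ffunE.
set q := qhit A eps P 1 in qp.
have q0 : 0 < q by apply: lt_le_trans qp.
have q20 : 0 < q / 2 by rewrite divr_gt0.
have [m m0 mC] := expR_small (((1 + n) ^ d)%:R * C1) C20 q20.
rewrite -mulrA in mC.
pose G : R := ((2 * (1 + (m + n) + n)) ^ d)%:R.
have G0 : 0 < G by rewrite ltr0n expn_gt0 muln_gt0.
have c0 : 0 < q / (2 * G) by rewrite divr_gt0// mulr_gt0.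
pose c := Num.min (q / (2 * G)) 1.
have cpos : 0 < c by rewrite lt_min c0 ltr01.
have c1 : c <= 1 by rewrite ge_min lexx orbT.
have cq : c * (1 * p) <= q / (2 * G).
  apply: (@le_trans _ _ c); last by rewrite ge_min lexx.
  by rewrite mul1r ler_piMr// ltW.
exists c => // t t0.
exact: (hit_error_tail d0 n0 stat C10 mix (ltn0Sn 0) m0 (leqnn (m + n))
  ltr01 p0 t0 (ltW cpos) c1 mC cq).
Qed.

Lemma small_patterns (R : realType) d (P : probability (Omega d) R) (C0 C1 C2 eps : R) (n0 : nat) :
  (0 < d)%N -> stationary_local P -> 0 < C1 -> 0 < C2 -> exp_mixing P C1 C2 ->
  (forall L eta, expR (- (#|` L|%:R * C0)) <= pr P (agree_on L eta)) -> 0 <= eps ->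
  exists2 c : R, 0 < c & forall n (A : patt d n), (n < n0)%N -> (0 < n)%N ->
    forall t, 0 < t -> hit_error P A eps 1 t <= (expR 1 + 1) * expR (- c * t).
Proof.
move=> d0 stat C10 C20 mix en eps0.
(* Patterns of all sizes below [n0] form one finite type, so a single rate can be taken below all of
   theirs. *)
pose T : finType := {n : 'I_n0 & patt d n}.
have ex (z : T) : exists c : R, 0 < c /\ ((0 < tag z)%N -> forall t, 0 < t ->
    hit_error P (tagged z) eps 1 t <= (expR 1 + 1) * expR (- c * t)).
  have [z0|z0] := posnP (tag z); first by exists 1; split=> //; rewrite z0.
  by have [c c0 h] := small_pattern (tagged z) d0 z0 stat C10 C20 mix en eps0; exists c.
have [c hc] := choice ex.
have [c0 c00 c0c] := finite_lower_bound (fun z => (hc z).1).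
exists c0 => // n A nn0 npos t t0.
pose z : T := Tagged (fun n : 'I_n0 => patt d n) (A : patt d (Ordinal nn0)).
apply: le_trans ((hc z).2 npos t t0) _.
rewrite ler_wpM2l ?addr_ge0 ?expR_ge0// ler_expR !mulNr lerN2 ler_wpM2r//.
exact: ltW.
Qed.

Theorem theorem2p6 (R : realType) (d : nat) (hd : (2 <= d)%N)
  (P Q : probability (Omega d) R)
  (HPgibbs : is_gibbs P) (HPmix : nonunif_exp_phi_mixing P)
  (HQgibbs : is_gibbs Q) (HQstat : stationary Q) (HQerg : ergodic Q)
  (eps0 : R)
  (HRpos : forall e : R, 0 <= e < eps0 ->
             cvgn (rate_distortion_n Q P e) /\ (0 < rate_distortion Q P e)%E)
  (alpha eps : R) (halpha : 0 < alpha < 1) (heps : 0 < eps < 1)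
  (hsmall : eps / alpha < eps0) :
  exists (L1 L2 C c K : R) (Lam : forall n : nat, patt d n -> R),
    [/\ 0 < L1, 0 < L2, 0 < C, 0 < c & 0 < K] /\
        (forall (n : nat) (A : patt d n), L1 <= Lam n A <= L2) /\
        forall (t : R) (n : nat), 0 < t -> (1 <= n)%N ->
          {ae Q, forall w : Omega d, good eps alpha (restr n w) ->
             `| fine (P [set s : Omega d | ((t / (Lam n (restr n w) *
                                       fine (P (approx_ball (restr n w) eps))))%:E
                                  < hitting_time (restr n w) eps s)%E])
                - expR (- t) |
             <= C * expR (- c * t) * expR (- K * (n ^ d)%:R)}.
Proof.
have d0 : (0 < d)%N by exact: ltnW.
have [Phi [HL HT HS DLR]] := HPgibbs.
have [C1 [C2 [C10 C20 mix]]] := exp_mixingP HPmix.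
have stat : stationary_local P.
  by move=> A E x; exact: (pr_tshift HL HT HS DLR C20 mix).
pose C0 : R := 2 * inorm Phi + ln 2.
have C00 : 0 < C0.
  have ln20 : (0 : R) < ln 2 by rewrite ln_gt0// ltr1n.
  by rewrite ltr_wpDl// mulr_ge0// inorm_ge0.
have en (L : {fset site d}) eta : expR (- (#|` L|%:R * C0)) <= pr P (agree_on L eta).
  exact: (pr_agree_on_ge HT HS DLR).
have /andP[eps0' _] := heps.
have [n0 [L1 [C [c [K [[/andP[L10 L11] Cp cp Kp] large]]]]]] :=
  large_patterns d0 stat C10 C20 mix C00 en heps halpha.
have [c' c'p small] := small_patterns n0 d0 stat C10 C20 mix en (ltW eps0').
pose cm := Num.min c c'.
have cmp : 0 < cm by rewrite lt_min cp.
have cmc : cm <= c by rewrite ge_min lexx.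
have cmc' : cm <= c' by rewrite ge_min lexx orbT.
(* For n < n0 the factor exp(K n0^d) compensates exp(- K n^d), which the bound for small patterns
   lacks. *)
pose E1 : R := (expR 1 + 1) * expR (K * (n0 ^ d)%:R).
have E10 : 0 < E1 by rewrite mulr_gt0 ?addr_gt0 ?expR_gt0.
have expt (a b t : R) : 0 < t -> a <= b -> expR (- b * t) <= expR (- a * t).
  by move=> t0 ab; rewrite ler_expR !mulNr lerN2 ler_wpM2r// ltW.
(* Packing size and pattern into one dependent pair lets [choice] produce the whole family at once.
   Patterns that are small or not good, and those with n = 0, get the value 1, which lies between
   [L1] and 2. *)
have ex (z : {n : nat & patt d n}) : exists Lam : R, L1 <= Lam <= 2 /\
    ((0 < tag z)%N -> good eps alpha (tagged z) -> forall t, 0 < t ->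
      hit_error P (tagged z) eps Lam t <=
        (C + E1) * expR (- cm * t) * expR (- K * (tag z ^ d)%:R)).
  case: z => n A /=.
  have one : L1 <= (1 : R) <= 2 by apply/andP; split; lra.
  have [n0n|nn0] := leqP n0 n; last first.
    exists 1; split=> // np _ t t0; apply: le_trans (small n A nn0 np t t0) _.
    have h : 1 <= expR (K * (n0 ^ d)%:R) * expR (- K * (n ^ d)%:R).
      rewrite -expRD -[leLHS]expR0 ler_expR mulNr -mulrBr mulr_ge0 ?(ltW Kp)//.
      by rewrite subr_ge0 ler_nat leq_exp2r// ltnW.
    apply: (@le_trans _ _ ((expR 1 + 1) * expR (- cm * t) *
      (expR (K * (n0 ^ d)%:R) * expR (- K * (n ^ d)%:R)))).
      apply: (@le_trans _ _ ((expR 1 + 1) * expR (- cm * t))).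
        by rewrite ler_wpM2l ?addr_ge0 ?expR_ge0// expt.
      by rewrite ler_peMr// mulr_ge0 ?addr_ge0 ?expR_ge0.
    rewrite mulrA ler_wpM2r ?expR_ge0// mulrAC ler_wpM2r ?expR_ge0//.
    by rewrite lerDr ltW.
  have [gA|nA] := pselect (good eps alpha A); last by exists 1.
  have [np|np] := posnP n; first by exists 1; split=> //; rewrite np.
  have [Lam [Lam01 h]] := large n A n0n np gA.
  exists Lam; split=> // _ _ t t0; apply: le_trans (h t t0) _.
  apply: ler_pM; rewrite ?mulr_ge0 ?expR_ge0 ?(ltW Cp)//.
    by apply: ler_pM; rewrite ?expR_ge0 ?(ltW Cp) ?lerDl ?(ltW E10)// expt.
  (* The estimate for large patterns decays in (n+1)^d, which is at least n^d. *)
  rewrite ler_expR !mulNr lerN2 ler_wpM2l ?(ltW Kp)// ler_nat.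
  by rewrite leq_exp2r.
have [F hF] := choice ex.
exists L1, 2, (C + E1), cm, K, (fun n A => F (existT _ n A)).
split; first by split=> //; exact: addr_gt0.
split=> [n A|t n t0 n1]; first exact: (hF (existT _ n A)).1.
apply: aeW => w gw.
exact: (hF (existT _ n (restr n w))).2.
Qed.
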